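(* Let $\Delta$ be a pure shellable simplicial complex on the vertex set $X=\{x_1,\ldots,x_n\}$, let $K$ be a field, $S=K[x_1,\ldots,x_n]$, and let $k>0$ be an integer. Then the expansion $K[\Delta]^{\mathbf{k}}=S^{\mathbf{k}}/(I_\Delta)^{\mathbf{k}}$ of the face ring $K[\Delta]=S/I_\Delta$ with respect to $k$ satisfies the Stanley conjecture, i.e. $\operatorname{sdepth}(K[\Delta]^{\mathbf{k}})\geq \operatorname{depth}(K[\Delta]^{\mathbf{k}})$. In particular, the face ring of a pure $k$-shellable simplicial complex satisfies the Stanley conjecture.
   Context: For a simplicial complex $\Delta$ on $X$, $I_\Delta\subset S$ is the Stanley–Reisner ideal (generated by the squarefree monomials $\prod_{x\in F}x$ with $F\notin\Delta$) and $K[\Delta]=S/I_\Delta$ is the face ring. For faces $F_1,\dots,F_s$, $\langle F_1,\ldots,F_s\rangle$ denotes the simplicial complex whose facets are $F_1,\dots,F_s$. $\Delta$ is shellable if its facets can be ordered $F_1,\ldots,F_r$ so that for all $j\geq 2$, $\langle F_j\rangle\cap\langle F_1,\ldots,F_{j-1}\rangle$ is pure of dimension $\dim F_j-1$. Expansion: $S^{\mathbf{k}}$ is the polynomial ring over $K$ in variables $x_{ij}$, $1\le i\le n$, $1\le j\le k$; $P_i=(x_{i1},\ldots,x_{ik})\subset S^{\mathbf{k}}$. For a monomial ideal $I\subset S$ minimally generated by $u_1,\ldots,u_r$, $I^{\mathbf{k}}=\sum_{i=1}^r P_1^{\nu_1(u_i)}\cdots P_n^{\nu_n(u_i)}$,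 where $\nu_j(u)$ is the exponent of $x_j$ in $u$; and $(S/I)^{\mathbf{k}}=S^{\mathbf{k}}/I^{\mathbf{k}}$. A $k$-shellable complex: let $\Delta$ have dimension $d$ and $1\le k\le d+1$; $\Delta$ is $k$-shellable if its facets can be ordered $F_1,\ldots,F_r$ such that for every $j=2,\ldots,r$, the complex $\Delta_j=\langle F_j\rangle\cap\langle F_1,\ldots,F_{j-1}\rangle$ satisfies (i) $\Delta_j$ is generated by a nonempty set of faces of $\langle F_j\rangle$ of dimension $|F_j|-k-1$; (ii) if $\Delta_j$ has more than one facet, then for every two distinct facets $\sigma,\tau$ of $\Delta_j$ we have $F_j\subseteq\sigma\cup\tau$. Stanley depth: for a finitely generated $\mathbb{Z}^n$-graded module $M$ over a polynomial ring, a Stanley space is $uK[Z]$ with $u\in M$ homogeneous and $Z$ a subset of the variables such that $uK[Z]$ is a free $K[Z]$-module of rank 1; a Stanley decomposition is a finite direct sum decomposition of $M$ (as a $K$-vector space) into Stanley spaces; its Stanley depth is the minimal $|Z|$ occurring; $\operatorname{sdepth}(M)$ is the maximum of this over all Stanley decompositions. The Stanley conjecture for $M$ is the inequality $\operatorname{sdepth}(M)\ge\operatorname{depth}(M)$. *)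

(* Defs.v *)
From HB Require Import structures.
From mathcomp Require Import all_boot all_algebra.
From mathcomp Require Import mpoly.
Set Implicit Arguments.
Unset Strict Implicit.
Unset Printing Implicit Defensive.
Import GRing.Theory.
Local Open Scope ring_scope.

Section Alg.
Variables (K : fieldType) (N : nat).
Local Notation P := {mpoly K[N]}.

Definition in_ideal (G : P -> Prop) (p : P) : Prop :=
  exists (r : nat) (c g : 'I_r -> P),
    (forall i, G (g i)) /\ p = \sum_(i < r) c i * g i.

Definition mon_gens (Gm : 'X_{1..N} -> Prop) : P -> Prop :=
  fun p => exists m, Gm m /\ p = 'X_[m].

Definition gens_plus (G : P -> Prop) (fs : seq P) : P -> Prop :=
  fun p => G p \/ p \in fs.

(* fs is an M-regular sequence (M = S/I, I = ideal generated by G)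
   consisting of elements of the graded maximal ideal m = (x_0..x_(N-1)) *)
Definition regular_seq (G : P -> Prop) (fs : seq P) : Prop :=
  (forall i, (i < size fs)%N -> (fs`_i)@_(0%MM) = 0) /\
  (forall i, (i < size fs)%N -> forall g : P,
      in_ideal (gens_plus G (take i fs)) (fs`_i * g) ->
      in_ideal (gens_plus G (take i fs)) g) /\
  ~ in_ideal (gens_plus G fs) 1.

Definition is_depth (G : P -> Prop) (d : nat) : Prop :=
  (exists fs, size fs = d /\ regular_seq G fs) /\
  (forall fs, regular_seq G fs -> (size fs <= d)%N).

Definition in_KZ (Z : {set 'I_N}) (p : P) : Prop :=
  forall m, m \in msupp p -> forall i, i \notin Z -> m i = 0%N.

Definition multihomog (u : P) : Prop := exists (c : K) (m : 'X_{1..N}), u = c *: 'X_[m].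

Definition stanley_decomp (G : P -> Prop) (r : nat) (u : 'I_r -> P)
    (Z : 'I_r -> {set 'I_N}) : Prop :=
  (* each u_i K[Z_i] is a Stanley space: u_i homogeneous, free of rank 1 *)
  (forall i, multihomog (u i) /\
     forall p, in_KZ (Z i) p -> in_ideal G (u i * p) -> p = 0) /\
  (forall f : P, exists ps : 'I_r -> P, (forall i, in_KZ (Z i) (ps i)) /\
      in_ideal G (f - \sum_(i < r) u i * ps i)) /\
  (forall ps : 'I_r -> P, (forall i, in_KZ (Z i) (ps i)) ->
      in_ideal G (\sum_(i < r) u i * ps i) -> forall i, in_ideal G (u i * ps i)).

Definition sdepth_ge (G : P -> Prop) (d : nat) : Prop :=
  exists r (u : 'I_r -> P) (Z : 'I_r -> {set 'I_N}),
    stanley_decomp G u Z /\ forall i, (d <= #|Z i|)%N.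

Definition stanley_conjecture (G : P -> Prop) : Prop :=
  forall d, is_depth G d -> sdepth_ge G d.

End Alg.

Definition min_gens n (Gm : 'X_{1..n} -> Prop) : 'X_{1..n} -> Prop :=
  fun u => Gm u /\ forall v, Gm v -> lem v u -> v = u.

(* variables of S^k : x_{ij}, i < n, j < k, indexed through enum_rank *)
Definition nvars (n k : nat) : nat := #|{: 'I_n * 'I_k}|.
Definition xidx n k (i : 'I_n) (j : 'I_k) : 'I_(nvars n k) := enum_rank (i, j).

(* monomial generators of I^k = sum_u P_1^{nu_1(u)} ... P_n^{nu_n(u)},
   u ranging over the minimal generators of I *)
Definition expansion_mon {n} (k : nat) (Gm : 'X_{1..n} -> Prop)
    : 'X_{1..nvars n k} -> Prop :=
  fun m => exists u, min_gens Gm u /\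
    forall i : 'I_n, (\sum_(j < k) m (xidx i j))%N = u i.
Arguments expansion_mon {n} k Gm _.

Section Complexes.
Variable n : nat.
Local Notation face := {set 'I_n}.

Definition simplicial_complex (D : {set face}) : Prop :=
  set0 \in D /\ forall F G : face, F \in D -> G \subset F -> G \in D.

Definition facets (D : {set face}) : {set face} :=
  [set F in D | [forall G in D, (F \subset G) ==> (G == F)]].

Definition pure (D : {set face}) : Prop :=
  forall F G, F \in facets D -> G \in facets D -> #|F| = #|G|.

Definition shell_inter (s : seq face) (j : nat) : {set face} :=
  [set G : face | (G \subset nth set0 s j) && has (fun F : face => G \subset F) (take j s)].

Definition facet_order (D : {set face}) (s : seq face) : Prop :=
  uniq s /\ forall F, (F \in s) = (F \in facets D).

(* shellable: Delta_j pure of dimension dim F_j - 1, i.e. all its facets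
   have cardinality |F_j| - 1 *)
Definition shellable (D : {set face}) : Prop :=
  exists s, facet_order D s /\
    forall j, (0 < j < size s)%N ->
      forall G, G \in facets (shell_inter s j) -> #|G| = (#|nth set0 s j| - 1)%N.

(* dim D + 1 = max cardinality of a face *)
Definition dim1 (D : {set face}) : nat := \max_(F in D) #|F|.

Definition k_shellable (D : {set face}) (k : nat) : Prop :=
  (1 <= k <= dim1 D)%N /\
  exists s, facet_order D s /\
    forall j, (0 < j < size s)%N ->
      let Fj := nth set0 s j in
      let Dj := shell_inter s j in
      (* (i) Dj is generated by faces of <F_j> of dimension |F_j|-k-1 *)
      (forall G, G \in facets Dj -> #|G| = (#|Fj| - k)%N) /\
      (forall s1 t1, s1 \in facets Dj -> t1 \in facets Dj -> s1 != t1 ->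
          Fj \subset s1 :|: t1).

(* monomial generators of the Stanley-Reisner ideal: x_F, F not a face *)
Definition SR_mon (D : {set face}) : 'X_{1..n} -> Prop :=
  fun m => (forall i, m i <= 1)%N /\ [set i | m i != 0%N] \notin D.

End Complexes.

Definition SR_ideal (K : fieldType) n (D : {set {set 'I_n}}) : {mpoly K[n]} -> Prop :=
  mon_gens (SR_mon D).

Definition SR_expansion (K : fieldType) n (k : nat) (D : {set {set 'I_n}})
    : {mpoly K[nvars n k]} -> Prop :=
  mon_gens (expansion_mon k (SR_mon D)).
Arguments SR_ideal K {n} D _.
Arguments SR_expansion K {n} k D _.

(* Main.v *)
(* Both parts concern a pure complex whose facets F_1, .., F_r, of size d, can be
   ordered so that F_j meets the earlier facets in the sets F_j \ A, where A runs
   over t_j pairwise disjoint k-subsets of F_j: for a k-shellable complex this is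
   the definition, and the expansion of a face ring is the face ring of the
   complex obtained by replacing every vertex by k copies of it.

   The new faces of F_j are those meeting all the sets A. Sorting them by the least
   element of their intersection with each A partitions the complex into intervals
   [T, Z], and the spaces x_T K[Z] form a Stanley decomposition with
   |Z| >= d - t_j (k - 1).

   Conversely depth <= d - t_j (k - 1) =: e for each j. A regular sequence of length
   > e would make the Koszul cohomology H^i(x_1^2, .., x_n^2; K[D]) vanish for
   i <= e. Its component of multidegree -G, where G is F_j minus all the sets A, is
   the cohomology of the cochains of D vanishing on the faces not containing G.
   Adding a facet contributes to that cohomology in degree e only, by purity, so a
   cocycle created by F_j survives to the end. *)
Require Import Defs.
From HB Require Import structures.
From mathcomp Require Import all_boot all_algebra.
From mathcomp Require Import mpoly.
From mathcomp Require Import ring zify.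
Set Implicit Arguments.
Unset Strict Implicit.
Unset Printing Implicit Defensive.
Import GRing.Theory.
Local Open Scope ring_scope.

(** * Koszul cochains *)

Definition incr N : rel 'I_N := fun u v => (u < v)%N.
Arguments incr {N}.

Lemma incr_trans N : transitive (@incr N).
Proof. by move=> v u w; apply: ltn_trans. Qed.

Lemma incr_path N (u : 'I_N) w : path incr u w = all (incr u) w && sorted incr w.
Proof. by rewrite path_sortedE //; apply: incr_trans. Qed.

Lemma incr_subseq N (s w : seq 'I_N) :
  subseq s w -> sorted incr w -> sorted incr s.
Proof. exact: (subseq_sorted (@incr_trans N)). Qed.

Lemma incr_uniq N (w : seq 'I_N) : sorted incr w -> uniq w.
Proof.
by apply: sorted_uniq; [apply: incr_trans | move=> x; rewrite /incr ltnn].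
Qed.

Definition ideal_pred (R : comNzRingType) (J : R -> Prop) : Prop :=
  [/\ J 0, forall a b, J a -> J b -> J (a + b) & forall r a, J a -> J (r * a)].

Section Ideal.
Variables (R : comNzRingType) (J : R -> Prop).
Hypothesis idJ : ideal_pred J.

Lemma ideal0 : J 0. Proof. by case: idJ. Qed.
Lemma idealD a b : J a -> J b -> J (a + b). Proof. by case: idJ => _ + _; apply. Qed.
Lemma idealM r a : J a -> J (r * a). Proof. by case: idJ => _ _; apply. Qed.
Lemma idealN a : J a -> J (- a). Proof. by rewrite -mulN1r; apply: idealM. Qed.
Lemma idealB a b : J a -> J b -> J (a - b).
Proof. by move=> Ja Jb; apply: idealD => //; apply: idealN. Qed.
Lemma ideal_sum (I : Type) (r : seq I) (P : pred I) (F : I -> R) :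
  (forall i, P i -> J (F i)) -> J (\sum_(i <- r | P i) F i).
Proof. by move=> JF; elim/big_ind: _ => //; [apply: ideal0 | apply: idealD]. Qed.
End Ideal.

Lemma zero_ideal (R : comNzRingType) : ideal_pred (fun a : R => a = 0).
Proof. by split=> // [a b -> ->|r a ->]; rewrite ?addr0 ?mulr0. Qed.

Section Koszul.
Variables (N : nat) (R : comNzRingType) (y : 'I_N -> R).
Implicit Types (c z : seq 'I_N -> R) (w s : seq 'I_N) (J : R -> Prop).

(* Koszul cochains are evaluated on strictly increasing sequences only; peeling
   off the smallest index makes the differential structurally recursive. *)
Fixpoint koszul_d c w : R :=
  if w is v :: w' then y v * c w' - koszul_d (fun s => c (v :: s)) w' else 0.

(** Interior product with the basis vector of v: v is inserted at its place in w, with the sign of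
    that insertion. *)
Fixpoint koszul_iota (v : 'I_N) c w : R :=
  if w is u :: w' then
    if (v < u)%N then c (v :: w)
    else if v == u then 0 else - koszul_iota v (fun s => c (u :: s)) w'
  else c [:: v].

Lemma koszul_d_ideal J c w : ideal_pred J ->
  (forall s, subseq s w -> (size s).+1 = size w -> J (c s)) -> J (koszul_d c w).
Proof.
move=> idJ; elim: w c => [|v w IH] c Jc /=; first exact: ideal0.
apply: idealB => //; last first.
  by apply: IH => s sw ss; apply: Jc => /=; rewrite ?eqxx // ss.
by apply: idealM => //; apply: Jc => //; apply: subseq_cons.
Qed.

Lemma koszul_d_lin a c1 c2 w :
  koszul_d (fun s => a * c1 s + c2 s) w = a * koszul_d c1 w + koszul_d c2 w.
Proof.
elim: w c1 c2 => [|v w IH] c1 c2 /=; first by rewrite mulr0 addr0.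
by rewrite IH; ring.
Qed.

Lemma koszul_d_eq0 c w :
  (forall s, subseq s w -> (size s).+1 = size w -> c s = 0) -> koszul_d c w = 0.
Proof. exact: (koszul_d_ideal (zero_ideal R)). Qed.

Lemma koszul_d_ext c1 c2 w :
  (forall s, subseq s w -> (size s).+1 = size w -> c1 s = c2 s) ->
  koszul_d c1 w = koszul_d c2 w.
Proof.
elim: w c1 c2 => [|v w IH] c1 c2 e //=.
rewrite (e w) ?subseq_cons //; congr (_ - _).
by apply: IH => s sw ss; apply: e => /=; rewrite ?eqxx ?ss.
Qed.

Lemma koszul_dZ a c w : koszul_d (fun s => a * c s) w = a * koszul_d c w.
Proof.
rewrite -[RHS]addr0 -(@koszul_d_eq0 (fun=> 0) w) // -koszul_d_lin.
by apply: koszul_d_ext => s _ _; rewrite addr0.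
Qed.

Lemma koszul_dD c1 c2 w : koszul_d (fun s => c1 s + c2 s) w = koszul_d c1 w + koszul_d c2 w.
Proof.
by rewrite -[koszul_d c1 w]mul1r -koszul_d_lin; apply: koszul_d_ext => s _ _; rewrite mul1r.
Qed.

Lemma koszul_dB c1 c2 w : koszul_d (fun s => c1 s - c2 s) w = koszul_d c1 w - koszul_d c2 w.
Proof.
rewrite koszul_dD -mulN1r -koszul_dZ; congr (_ + _).
by apply: koszul_d_ext => s _ _; rewrite mulN1r.
Qed.

Lemma koszul_d_d c w : koszul_d (koszul_d c) w = 0.
Proof.
elim: w c => [|v w IH] c //=.
by rewrite koszul_dB koszul_dZ IH subr0 subrr.
Qed.

Lemma koszul_d_sum (I : Type) (r : seq I) (F : I -> seq 'I_N -> R) w :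
  koszul_d (fun s => \sum_(i <- r) F i s) w = \sum_(i <- r) koszul_d (F i) w.
Proof.
elim: r => [|i r IH]; first by rewrite big_nil; apply: koszul_d_eq0 => s; rewrite big_nil.
by rewrite big_cons -IH -koszul_dD; apply: koszul_d_ext => s _ _; rewrite big_cons.
Qed.

Lemma koszul_iota_linB v a c1 c2 w :
  koszul_iota v (fun s => a * c1 s - c2 s) w = a * koszul_iota v c1 w - koszul_iota v c2 w.
Proof.
elim: w c1 c2 => [|u w IH] c1 c2 //=.
by case: ifP => _ //; case: ifP => _; rewrite ?IH; ring.
Qed.

Lemma koszul_iota_ideal J v c w : ideal_pred J -> sorted incr w ->
  (v \notin w -> forall s, sorted incr s -> s =i v :: w ->
     size s = (size w).+1 -> J (c s)) ->
  J (koszul_iota v c w).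
Proof.
move=> idJ; elim: w c => [|u w IH] c /=; first by move=> _; apply.
rewrite incr_path => /andP[uw sw] Jc; case: ltnP => [vu|uv].
  have vw : all (incr v) w by apply: sub_all uw => x; apply: (ltn_trans vu).
  apply: Jc => //; last by rewrite [sorted _ _]/= incr_path uw sw /incr vu.
  rewrite inE negb_or -val_eqE /= neq_ltn vu /=.
  by apply/negP => /(allP vw); rewrite /incr ltnn.
case: eqVneq => [_|vu]; first exact: ideal0.
apply: idealN => //; apply: IH => // vw s ss sE sz; apply: Jc.
- by rewrite inE negb_or vu.
- rewrite /= incr_path ss andbT; apply/allP => x; rewrite sE inE.
  case/predU1P => [->|/(allP uw)//].
  by rewrite /incr ltn_neqAle uv eq_sym val_eqE vu.
- by move=> x; rewrite !inE sE !inE orbCA.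
- by rewrite /= sz.
Qed.

(** Cartan's homotopy formula: multiplication by [y v] is null-homotopic. If v precedes the head u,
    insertion always happens in front and everything else cancels; if v = u, only the term removing
    u survives; if v comes later, the identity for the tail is used. *)
Lemma koszul_d_iota v c w : sorted incr w ->
  koszul_d (koszul_iota v c) w + koszul_iota v (koszul_d c) w = y v * c w.
Proof.
elim: w c => [|u w IH] c; first by rewrite /= subr0 add0r.
have -> : koszul_d (koszul_iota v c) (u :: w) =
  y u * koszul_iota v c w - koszul_d (fun s => koszul_iota v c (u :: s)) w by [].
rewrite [sorted _ _]/= incr_path => /andP[uw sw].
case: (ltngtP v u) => [vu|uv|/val_inj vu].
- have H s : subseq s (u :: w) -> koszul_iota v c s = c (v :: s).
    case: s => // x s /mem_subseq/(_ x); rewrite inE eqxx => /(_ isT).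
    rewrite inE => /predU1P[->|/(allP uw)]; rewrite /= ?vu // /incr => ux.
    by rewrite (ltn_trans vu).
  rewrite H ?subseq_cons // (@koszul_d_ext _ (fun s => c [:: v, u & s])) => [|s sw' _].
    by rewrite /= vu; ring.
  by rewrite H //= eqxx.
- have vu : (v == u) = false by rewrite -val_eqE /= gtn_eqF.
  have uvF : (v < u)%N = false by rewrite ltnNge ltnW.
  rewrite (@koszul_d_ext _ (fun s => -1 * koszul_iota v (fun s => c (u :: s)) s)) => [|s _ _].
    rewrite koszul_dZ /= uvF vu koszul_iota_linB -(IH (fun s => c (u :: s))) //; ring.
  by rewrite /= uvF vu mulN1r.
- rewrite {IH}vu {v vu} (@koszul_d_eq0 (fun s => koszul_iota u c (u :: s))).
    rewrite /= ltnn eqxx subr0 addr0; case: w {sw} uw => [//|x w] /= /andP[].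
    by rewrite /incr => ->.
  by move=> s _ _; rewrite /= ltnn eqxx.
Qed.
End Koszul.

(** * Vanishing below the length of a regular sequence *)

(** Sequences of a fixed length over a finite type form a finite type, so a choice function on them
    exists without any axiom. *)
Lemma seq_choice (T : finType) (R : Type) (r0 : R) n (P : seq T -> R -> Prop) :
  (forall s, size s = n -> exists b, P s b) ->
  exists b : seq T -> R, forall s, size s = n -> P s (b s).
Proof.
move=> H; have [b bP] : exists b : n.-tuple T -> R, forall s, P (val s) (b s).
  by apply: (@fin_all_exists _ _ (fun s => P (val s))) => s; apply: H; rewrite size_tuple.
exists (fun s => if insub s is Some t then b t else r0) => s /eqP ss.
by rewrite insubT /=; apply: (bP (Tuple ss)).
Qed.

Section Depth.
Variable R : comNzRingType.
Implicit Types (J : R -> Prop) (f g : R) (fs : seq R).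

Definition ideal_adjoin J f : R -> Prop := fun p => exists a, J (p - f * a).

(** The ideal J grows along the sequence while the ring stays fixed, so that no quotient ring is
    formed. *)
Fixpoint quot_regular J fs : Prop :=
  if fs is f :: fs' then
    (forall g, J (f * g) -> J g) /\ quot_regular (ideal_adjoin J f) fs'
  else True.

Lemma ideal_adjoin_ideal J f : ideal_pred J -> ideal_pred (ideal_adjoin J f).
Proof.
move=> idJ; split.
- by exists 0; rewrite mulr0 subr0; apply: ideal0.
- move=> a b [u Ju] [v Jv]; exists (u + v).
  by rewrite mulrDr opprD addrACA; apply: idealD.
- move=> r a [u Ju]; exists (r * u).
  by rewrite (_ : _ - _ = r * (a - f * u)); [apply: idealM | ring].
Qed.

Variables (N : nat) (y : 'I_N -> R).
Local Notation d := (koszul_d y).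

Definition cocycle J i (z : seq 'I_N -> R) : Prop :=
  forall w, sorted incr w -> size w = i.+1 -> J (d z w).
Definition coboundary J i (z : seq 'I_N -> R) : Prop :=
  exists c, forall w, sorted incr w -> size w = i -> J (z w - d c w).

(* f is injective on the i-th Koszul cohomology of R/J as soon as it is
   R/J-regular and the (i-1)-st cohomology of R/(J,f) vanishes. *)
Lemma coboundary_cancel J f i z : ideal_pred J -> (forall g, J (f * g) -> J g) ->
  (forall i' z', i = i'.+1 -> cocycle (ideal_adjoin J f) i' z' ->
     coboundary (ideal_adjoin J f) i' z') ->
  coboundary J i (fun s => f * z s) -> coboundary J i z.
Proof.
move=> idJ regf; case: i => [_ [w Hw]|i' /(_ i' _ erefl) IH [w Hw]].
  exists w => -[|//] _ _; rewrite /= subr0; apply: regf.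
  by have := Hw [::] isT erefl; rewrite /= subr0.
(* From f z = d w modulo J, w is a cocycle modulo (J, f). Writing w = d c + f b modulo J gives f z =
   f d b, and f cancels. *)
have /IH[c Hc] : cocycle (ideal_adjoin J f) i' w.
  move=> s ss sz; exists (z s); rewrite -opprB; apply: idealN => //; exact: Hw.
have [b Hb] : exists b : seq 'I_N -> R, forall s, size s = i' ->
    sorted incr s -> J (w s - d c s - f * b s).
  apply: (@seq_choice _ _ 0 i' (fun s b => sorted incr s -> J (w s - d c s - f * b))).
  move=> s sz; case ss : (sorted incr s); last by exists 0.
  by have [a Ja] := Hc s ss sz; exists a.
exists b => s ss sz; apply: regf.
have -> : f * (z s - d b s) =
    (f * z s - d w s) + d (fun u => w u - d c u - f * b u) s.
  by rewrite !koszul_dB koszul_dZ koszul_d_d; ring.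
apply: idealD => //; first exact: Hw.
apply: koszul_d_ideal => // u us su; apply: Hb.
  by move: su; rewrite sz => -[].
exact: incr_subseq us ss.
Qed.

(** The first element f acts nilpotently on the cohomology, a power of it being a combination of the
    null-homotopic [y v]. By induction on the sequence it also acts injectively in degree i, so that
    this cohomology is zero. *)
Lemma koszul_vanishing J fs : ideal_pred J -> quot_regular J fs ->
  (forall f, f \in fs -> exists m (g : 'I_N -> R), f ^+ m = \sum_v g v * y v) ->
  forall i, (i < size fs)%N -> forall z, cocycle J i z -> coboundary J i z.
Proof.
elim: fs J => [//|f fs IH] J idJ [regf regfs] nil i ilt.
have [m [g fm]] := nil f (mem_head _ _).
have cancel z : coboundary J i (fun s => f * z s) -> coboundary J i z.
  apply: coboundary_cancel => // i' z' ii'; apply: IH.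
  - exact: ideal_adjoin_ideal.
  - by [].
  - by move=> h hfs; apply: nil; rewrite inE hfs orbT.
  - by move: ilt; rewrite ii'.
have cancelX z : coboundary J i (fun s => f ^+ m * z s) -> coboundary J i z.
  elim: m {fm} z => [|m IHm] z [c Hc].
    by exists c => s ss sz; rewrite -[z s]mul1r; apply: Hc.
  apply: cancel; apply: IHm; exists c => s ss sz.
  by rewrite mulrA -exprSr; apply: Hc.
move=> z Hz; apply: cancelX.
(* The homotopy formula, summed with the coefficients of [f ^+ m], gives a primitive of [f ^+ m * z]
   modulo J. *)
exists (fun s => \sum_v g v * koszul_iota v z s) => s ss sz.
rewrite fm mulr_suml koszul_d_sum -sumrB; apply: ideal_sum => // v _.
rewrite koszul_dZ -mulrA -(koszul_d_iota _ _ _ ss) mulrDr addrAC subrr add0r.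
apply: idealM => //; apply: koszul_iota_ideal => // _ u su _ szu.
by apply: Hz; rewrite // szu sz.
Qed.

End Depth.

(** * The face ring in a negative multidegree *)

Lemma mcoeffXM (K : fieldType) N (u m : 'X_{1..N}) (p : {mpoly K[N]}) :
  ('X_[u] * p)@_m = if lem u m then p@_(m - u)%MM else 0.
Proof.
case: ifP => [le_um|nle]; first by rewrite mulrC -[m in LHS](submK le_um) addmC mcoeffMX.
apply: memN_msupp_eq0; rewrite mulrC (perm_mem (msuppMX _ _)).
by apply/negP => /mapP[k _ mE]; rewrite mE lem_addr in nle.
Qed.

(** * Ideals of the polynomial ring and regular sequences *)

Section InIdeal.
Variables (K : fieldType) (N : nat).
Local Notation P := {mpoly K[N]}.
Implicit Types (G : P -> Prop) (p f : P) (fs : seq P).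

Lemma in_ideal_ideal G : ideal_pred (in_ideal G).
Proof.
split.
- by exists 0%N, (fun=> 0), (fun=> 0); split; [case | rewrite big_ord0].
- move=> _ _ [r1 [c1 [g1 [G1 ->]]]] [r2 [c2 [g2 [G2 ->]]]].
  exists (r1 + r2)%N.
  exists (fun i => match split i with inl j => c1 j | inr j => c2 j end).
  exists (fun i => match split i with inl j => g1 j | inr j => g2 j end).
  split=> [i|]; first by case: (split i).
  rewrite big_split_ord /=; congr (_ + _); apply: eq_bigr => i _.
    by case: splitP => j /= e; [rewrite (_ : i = j) //; apply: val_inj
      | have := ltn_ord i; rewrite e ltnNge leq_addr].
  case: splitP => j /= e; last first.
    by rewrite (_ : i = j) //; apply/val_inj/eqP; rewrite -(eqn_add2l r1) e.
  by have := ltn_ord j; rewrite -e ltnNge leq_addr.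
- move=> a _ [r [c [g [Gg ->]]]]; exists r, (fun i => a * c i), g; split=> //.
  by rewrite mulr_sumr; apply: eq_bigr => i _; rewrite mulrA.
Qed.

Lemma in_ideal_gen G p : G p -> in_ideal G p.
Proof.
move=> Gp; exists 1%N, (fun=> 1), (fun=> p); split=> //.
by rewrite big_ord1 mul1r.
Qed.

Lemma in_ideal_min G (J : P -> Prop) p : ideal_pred J ->
  (forall g, G g -> J g) -> in_ideal G p -> J p.
Proof.
move=> idJ GJ [r [c [g [Gg ->]]]]; apply: ideal_sum => // i _.
by apply: idealM => //; apply: GJ.
Qed.

Lemma quot_regular_ext (J J' : P -> Prop) fs : (forall p, J p <-> J' p) ->
  quot_regular J fs -> quot_regular J' fs.
Proof.
elim: fs J J' => [//|f fs IH] J J' JJ /= [regf regfs]; split.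
  by move=> g /JJ/regf/JJ.
by apply: IH regfs => p; split=> -[a Ja]; exists a; apply/JJ.
Qed.

Lemma ideal_adjoinE G fs f p : ideal_adjoin (in_ideal (gens_plus G fs)) f p <->
  in_ideal (gens_plus G (rcons fs f)) p.
Proof.
have sub q : in_ideal (gens_plus G fs) q -> in_ideal (gens_plus G (rcons fs f)) q.
  apply: in_ideal_min => [|g Gg]; first exact: in_ideal_ideal.
  apply: in_ideal_gen; case: Gg => [|gfs]; first by left.
  by right; rewrite mem_rcons inE gfs orbT.
split=> [[a /sub Ha]|].
  rewrite -(subrK (f * a) p); apply: (idealD (in_ideal_ideal _)) Ha _.
  rewrite mulrC; apply: (idealM (in_ideal_ideal _)); apply: in_ideal_gen.
  by right; rewrite mem_rcons mem_head.
apply: in_ideal_min => [|g]; first exact: (ideal_adjoin_ideal _ (in_ideal_ideal _)).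
case=> [Gg|]; last rewrite mem_rcons inE => /predU1P[->|gfs].
- by exists 0; rewrite mulr0 subr0; apply: in_ideal_gen; left.
- exists 1; rewrite mulr1 subrr; exact: (ideal0 (in_ideal_ideal _)).
- by exists 0; rewrite mulr0 subr0; apply: in_ideal_gen; right.
Qed.

Lemma regular_seq_quot_regular G fs :
  regular_seq G fs -> quot_regular (in_ideal G) fs.
Proof.
case=> _ [reg _].
have {}reg : quot_regular (in_ideal (gens_plus G [::])) fs.
  (* The empty sequence is inserted to be generalised to the prefix of elements already adjoined,
     over which the induction runs. *)
  have : forall i, (i < size fs)%N -> forall g,
    in_ideal (gens_plus G ([::] ++ take i fs)) (fs`_i * g) ->
    in_ideal (gens_plus G ([::] ++ take i fs)) g by [].
  move: [::] => pre; elim: fs {reg} pre => [//|f fs IH] pre reg /=; split.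
    by have := reg 0%N isT; rewrite take0 cats0.
  apply: (quot_regular_ext (fun p => iff_sym (ideal_adjoinE _ _ _ p))).
  by apply: IH => i ilt g; rewrite cat_rcons; apply: (reg i.+1).
apply: quot_regular_ext reg => p.
by split; apply: in_ideal_min; try exact: in_ideal_ideal; move=> g Gg;
  apply: in_ideal_gen; [case: Gg | left].
Qed.

(** With squares, the summand at w in multidegree -G sits in degree 2w - G of the face ring; for G
    inside w this exponent has support exactly w, so the summand detects whether w is a face. *)
Definition squared_var (v : 'I_N) : P := 'X_[U_(v) + U_(v)].

(** The square of a nonconstant monomial is divisible by the square of a variable, and having a
    power in an ideal is preserved by sums: in the expansion of (p + q)^(a+b) each term contains p^a
    or q^b. *)
Lemma power_in_squared_vars f : f@_0%MM = 0 ->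
  exists m (g : 'I_N -> P), f ^+ m = \sum_v g v * squared_var v.
Proof.
pose J p := exists g : 'I_N -> P, p = \sum_v g v * squared_var v.
have idJ : ideal_pred J.
  split.
  - by exists (fun=> 0); rewrite big1 // => v _; rewrite mul0r.
  - move=> _ _ [g ->] [h ->]; exists (fun v => g v + h v).
    by rewrite -big_split; apply: eq_bigr => v _; rewrite mulrDl.
  - move=> r _ [g ->]; exists (fun v => r * g v).
    by rewrite mulr_sumr; apply: eq_bigr => v _; rewrite mulrA.
move=> f0; suff : exists m, J (f ^+ m) by case=> m [g fE]; exists m, g.
rewrite [f]mpolyE big_seq; elim/big_ind: _ => [|p q [a Ja] [b Jb]|m mf].
- by exists 1%N; rewrite expr1; apply: ideal0.
- exists (a + b)%N; rewrite exprDn; apply: ideal_sum => // i _.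
  rewrite -mulr_natl; apply: idealM => //; case: (leqP b i) => [bi|ib].
    by rewrite -(subnK bi) exprD mulrA; apply: idealM.
  by rewrite -addnBA ?(ltnW ib) // exprD -mulrA mulrC; apply: idealM.
- exists 2%N; have /existsP[v mv] : [exists v, m v != 0%N].
    rewrite -negb_forall; apply/negP => /forallP m0.
    move: mf; rewrite mcoeff_msupp (_ : m = 0%MM) ?f0 ?eqxx //.
    by apply/mnmP => v; rewrite mnm0E; apply/eqP.
  exists (fun u => if u == v then f@_m ^+ 2 *: 'X_[(m - U_(v)) + (m - U_(v))] else 0).
  rewrite (bigD1 v) //= eqxx big1 => [|u /negbTE->]; last by rewrite mul0r.
  rewrite addr0 -scalerAl -mpolyXD exprZn mpolyXn; congr (_ *: 'X_[_]).
  apply/mnmP => u; rewrite mulmS mulm1n !mnmDE !mnmBE mnm1E.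
  by case: eqVneq => [<-|_]; lia.
Qed.
End InIdeal.

Definition supp N (m : 'X_{1..N}) : {set 'I_N} := [set i | m i != 0%N].

Lemma supp_sub N (m u : 'X_{1..N}) : lem u m -> supp u \subset supp m.
Proof.
move=> /mnm_lepP um; apply/subsetP => i; rewrite !inE -!lt0n => ui.
exact: leq_trans (um i).
Qed.

Section FaceIdeal.
Variables (K : fieldType) (N : nat) (face : pred {set 'I_N}).
Hypothesis face_sub : forall A B : {set 'I_N}, A \subset B -> face B -> face A.
(** Any monomials whose multiples are exactly the monomials with nonface support; this covers both
    the generators of a Stanley-Reisner ideal and those of its expansion. *)
Variable Gm : 'X_{1..N} -> Prop.
Hypothesis Gm_nonface : forall m, Gm m -> ~~ face (supp m).
Hypothesis nonface_Gm : forall m, ~~ face (supp m) -> exists2 u, Gm u & lem u m.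
Local Notation P := {mpoly K[N]}.
Local Notation I := (in_ideal (@mon_gens K N Gm)).

Lemma in_face_ideal (p : P) : I p <-> forall m, face (supp m) -> p@_m = 0.
Proof.
split=> [[r [c [g [Gg ->]]]] m fm|p0].
  rewrite raddf_sum big1 // => i _; have [u [Gu Gu2]] := Gg i.
  rewrite Gu2 mulrC /= mcoeffXM; case: ifP => // /supp_sub/face_sub/(_ fm).
  by rewrite (negbTE (Gm_nonface Gu)).
rewrite [p]mpolyE big_seq; apply: ideal_sum => [|m mp]; first exact: in_ideal_ideal.
have /nonface_Gm[u Gu um] : ~~ face (supp m).
  by apply/negP => /p0/eqP; rewrite mcoeff_eq0 mp.
rewrite -(submK um) mpolyXD scalerAl; apply: (idealM (in_ideal_ideal _)).
by apply: in_ideal_gen; exists u.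
Qed.

Local Notation delta := (koszul_d (fun=> 1 : K)).

Section MultiDegree.
Variable G : {set 'I_N}.

(* The exponent of the Z^N-degree -G component at the basis element of the
   Koszul complex on the squares of the variables indexed by w. *)
Let e (w : seq 'I_N) : 'X_{1..N} := [multinom ((v \in w).*2 - (v \in G))%N | v < N].

Let eS p v w : uniq (p ++ v :: w) -> v \notin G ->
  e (p ++ v :: w) = (U_(v) + U_(v) + e (p ++ w))%MM.
Proof.
rewrite (perm_uniq (permEl (perm_catCA p [:: v] w))) /= => /andP[vn _] vG.
apply/mnmP => u; rewrite !mnmDE mnm1E !mnmE mem_cat inE orbCA -mem_cat.
case: (eqVneq u v) => [->|uv]; first by rewrite (negbTE vn) (negbTE vG).
by [].
Qed.

(** Scalar cochains embed as the multidegree -G part of the Koszul complex. The prefix p holds the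
    indices already peeled off. An index v is removed with nonzero effect only if G lies in the
    remaining indices, hence v is not in G and the exponent changes by exactly 2. *)
Lemma koszul_d_degree_part (phi : seq 'I_N -> K) p w : uniq (p ++ w) ->
  (forall s, ~~ (G \subset s) -> phi s = 0) ->
  koszul_d (@squared_var K N) (fun s => phi (p ++ s) *: 'X_[e (p ++ s)]) w =
  delta (fun s => phi (p ++ s)) w *: 'X_[e (p ++ w)].
Proof.
move=> + phi0; elim: w p => [|v w IH] p upw /=; first by rewrite scale0r.
have := IH (rcons p v); rewrite cat_rcons => /(_ upw).
rewrite (@koszul_d_ext _ _ _ _ (fun s => phi (p ++ v :: s) *: 'X_[e (p ++ v :: s)])); last first.
  by move=> s _ _; rewrite cat_rcons.
rewrite (@koszul_d_ext _ _ (fun=> 1) _ (fun s => phi (p ++ v :: s))); last first.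
  by move=> s _ _; rewrite cat_rcons.
move=> ->; rewrite scalerBl mul1r -scalerAr; congr (_ - _).
have [/subsetP Gpw|/phi0->] := boolP (G \subset p ++ w); last by rewrite !scale0r.
suff vG : v \notin G by rewrite eS // [in RHS]mpolyXD.
apply/negP => /Gpw; apply/negP.
by move: upw; rewrite (perm_uniq (permEl (perm_catCA p [:: v] w))) /= => /andP[].
Qed.

(** Projection onto the multidegree -G part, which also commutes with the differentials. *)
Lemma koszul_d_degree_coeff (c : seq 'I_N -> P) p w : uniq (p ++ w) -> G \subset p ++ w ->
  (koszul_d (@squared_var K N) (fun s => c (p ++ s)) w)@_(e (p ++ w)) =
  delta (fun s => if G \subset p ++ s then (c (p ++ s))@_(e (p ++ s)) else 0) w.
Proof.
elim: w p => [|v w IH] p upw Gpw /=; first by rewrite mcoeff0.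
have := IH (rcons p v); rewrite cat_rcons => /(_ upw Gpw).
rewrite (@koszul_d_ext _ _ _ _ (fun s => c (p ++ v :: s))); last first.
  by move=> s _ _; rewrite cat_rcons.
rewrite [in RHS](@koszul_d_ext _ _ (fun=> 1) _ (fun s =>
  if G \subset p ++ v :: s then (c (p ++ v :: s))@_(e (p ++ v :: s)) else 0));
  last first.
  by move=> s _ _; rewrite cat_rcons.
rewrite mcoeffB => ->; congr (_ - _); rewrite mul1r /squared_var mcoeffXM.
have vn : v \notin p ++ w.
  by move: upw; rewrite (perm_uniq (permEl (perm_catCA p [:: v] w))) /= => /andP[].
(* For v in G the exponent at v is 2 - 1 = 1, so the square of the variable does not divide the
   monomial; on the other side G is not contained in what remains. *)
have [vG|vG] := boolP (v \in G).
  rewrite (_ : G \subset p ++ w = false); last first.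
    by apply/negbTE; apply: contra vn => /subsetP; apply.
  case: ifP => // /mnm_lepP/(_ v).
  by rewrite mnmDE mnm1E eqxx !mnmE mem_cat inE eqxx orbT vG.
rewrite eS // lem_addr addmC addmK [in RHS](_ : G \subset p ++ w) //.
apply/subsetP => x xG; have := subsetP Gpw x xG.
by rewrite !mem_cat inE; case: eqVneq xG vG => [-> ->|].
Qed.

(* The degree -G component of H^i(x_1^2, .., x_N^2; K[D]) is the i-th cohomology of
   the cochains of D that vanish on the faces not containing G. *)
Lemma relative_vanishing (fs : seq P) i (phi : seq 'I_N -> K) :
  regular_seq (mon_gens Gm) fs -> (i < size fs)%N ->
  (forall s, ~~ (G \subset s) -> phi s = 0) ->
  (forall w, sorted incr w -> face [set x in w] -> size w = i.+1 -> delta phi w = 0) ->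
  exists2 psi : seq 'I_N -> K, (forall s, ~~ (G \subset s) -> psi s = 0) &
    forall w, sorted incr w -> face [set x in w] -> size w = i -> phi w = delta psi w.
Proof.
move=> reg ilt phi0 phic.
have supp_e w : G \subset w -> supp (e w) = [set x in w].
  move=> /subsetP Gw; apply/setP => x; rewrite !inE mnmE; have := Gw x.
  by case: (x \in w) => [_|]; case: (x \in G) => // /(_ isT).
have nil f : f \in fs -> exists m (g : 'I_N -> P), f ^+ m = \sum_v g v * squared_var K v.
  move=> /(nthP 0)[j jlt <-]; apply: power_in_squared_vars.
  by case: reg => + _; apply.
(* The homogeneous lift of phi is a cocycle modulo the face ideal: on faces by hypothesis, on
   nonfaces containing G because the monomial lies in the ideal. *)
have [|c Hc] := koszul_vanishing (in_ideal_ideal _) (regular_seq_quot_regular reg)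
    nil ilt (z := fun s => phi s *: 'X_[e s]).
  move=> w sw szw; rewrite (koszul_d_degree_part (p := [::])) //; last exact: incr_uniq.
  have [fw|fw] := boolP (face [set x in w]).
    by rewrite phic // scale0r; exact: (ideal0 (in_ideal_ideal _)).
  have [Gw|Gw] := boolP (G \subset w).
    apply/in_face_ideal => m fm; rewrite mcoeffZ mcoeffX.
    by case: eqP fm => [<-|]; rewrite ?mulr0 //= supp_e // (negbTE fw).
  rewrite koszul_d_eq0 ?scale0r; first exact: (ideal0 (in_ideal_ideal _)).
  move=> s sw' _; apply: phi0; apply: contra Gw => /subsetP Gs.
  by apply/subsetP => x /Gs; apply: mem_subseq.
exists (fun s => if G \subset s then (c s)@_(e s) else 0) => [s /negbTE->//|w sw fw szw].
have [Gw|Gw] := boolP (G \subset w); last first.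
  rewrite phi0 // koszul_d_eq0 // => s sw' _; case: ifP => // /subsetP Gs.
  by case/subsetP: Gw => x /Gs; apply: mem_subseq.
have /in_face_ideal/(_ (e w)) := Hc w sw szw.
rewrite supp_e // => /(_ fw); rewrite mcoeffB mcoeffZ mcoeffX eqxx mulr1.
move=> /subr0_eq ->; apply: (@koszul_d_degree_coeff c [::] w) => //.
exact: incr_uniq.
Qed.
End MultiDegree.
End FaceIdeal.

(** * Relative cohomology of a block of a simplex *)

Section RelativeSimplex.
Variables (N : nat) (R : comNzRingType).
Implicit Types (F G A : {set 'I_N}) (As : seq {set 'I_N}) (w s : seq 'I_N).
Implicit Types (phi psi : seq 'I_N -> R) (Q : pred (seq 'I_N)).
Local Notation delta := (koszul_d (fun=> 1 : R)).

Definition rel_face F G As w :=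
  [&& w \subset F, G \subset w & all (fun A => has (mem A) w) As].

Definition disjoint_family As := pairwise (fun A B => [disjoint A & B]) As.

Lemma subseq_subset s w : subseq s w -> s \subset w.
Proof. by move=> sw; apply/subsetP => x; apply: mem_subseq. Qed.

Lemma rel_face_up F G As s w : s \subset w -> w \subset F -> rel_face F G As s -> rel_face F G As w.
Proof.
move=> sw wF /and3P[_ Gs /allP As_s]; apply/and3P; split=> //.
  exact: subset_trans sw.
apply/allP => A /As_s/hasP[x xs xA]; apply/hasP; exists x => //.
exact: (subsetP sw).
Qed.

Lemma delta_support Q phi w : (forall s, ~~ Q s -> phi s = 0) ->
  (forall s, subseq s w -> ~~ Q s) -> delta phi w = 0.
Proof. by move=> phi0 wQ; apply: koszul_d_eq0 => s sw _; apply/phi0/wQ. Qed.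

(** A cone argument: contraction with a is a homotopy between the identity and 0, and it preserves
    support in Q because Q is stable under deleting a. *)
Lemma toggle_acyclic F Q a i phi : a \in F ->
  (forall s w, s =i a :: w -> a \notin w -> w \subset F -> Q s -> Q w) ->
  (forall w, sorted incr w -> w \subset F -> size w = i -> ~~ Q w -> phi w = 0) ->
  (forall w, sorted incr w -> w \subset F -> size w = i.+1 -> delta phi w = 0) ->
  exists2 psi, (forall w, ~~ Q w -> psi w = 0) &
    forall w, sorted incr w -> w \subset F -> size w = i -> phi w = delta psi w.
Proof.
move=> aF Qa phi0 phic.
have sF s w : s =i a :: w -> w \subset F -> s \subset F.
  move=> sE /subsetP wF; apply/subsetP => x; rewrite sE inE.
  by case/predU1P => [->|/wF].
exists (fun w => if Q w then koszul_iota a phi w else 0) => [w /negbTE->//|w sw wF szw].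
rewrite -[phi w]mul1r -(koszul_d_iota (fun=> 1) a phi sw).
rewrite (_ : koszul_iota a _ w = 0) ?addr0; last first.
  apply: (koszul_iota_ideal (zero_ideal R)) => // _ s ss sE szs.
  by apply: phic => //; [apply: sF sE wF | rewrite szs szw].
apply: koszul_d_ext => s sw' szs; case: ifP => // /negP Qs.
have ss := incr_subseq sw' sw.
have sF' : s \subset F := subset_trans (subseq_subset sw') wF.
apply: (koszul_iota_ideal (zero_ideal R)) => // as' u su uE szu; apply: phi0 => //.
- exact: sF uE _.
- by rewrite szu szs.
- by apply/negP => /(Qa _ _ uE as' sF').
Qed.

Lemma subset_setD_setD1 F A a w : w \subset F ->
  (w \subset F :\: (A :\ a)) = ~~ has (mem (A :\ a)) w.
Proof.
move=> /subsetP wF; apply/subsetP/hasPn => H x xw; have := H x xw.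
  by rewrite /= !inE => /andP[].
by rewrite /= !inE => ->; apply: wF.
Qed.

Lemma subset_U1_seq G a w : (a |: G \subset w) = (a \in w) && (G \subset w).
Proof.
apply/subsetP/andP => [aGw|[aw /subsetP Gw] x].
  split; first by apply: aGw; rewrite setU11.
  by apply/subsetP => x xG; apply: aGw; rewrite setU1r.
by rewrite !inE => /predU1P[->//|/Gw].
Qed.

(** Once all elements of A but a are discarded, meeting A means containing a. *)
Lemma rel_face_shrink F G A As a w : a \in A -> w \subset F :\: (A :\ a) ->
  rel_face (F :\: (A :\ a)) (a |: G) As w = rel_face F G (A :: As) w.
Proof.
move=> aA wF'; have wF : w \subset F by apply: subset_trans wF' (subsetDl _ _).
rewrite /rel_face wF wF' /= subset_U1_seq.
rewrite [(a \in w) && _]andbC -andbA; congr (_ && (_ && _)).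
apply/idP/hasP => [aw|[x xw /= xA]]; first by exists a.
move: wF'; rewrite subset_setD_setD1 // => /hasPn/(_ x xw).
by rewrite /= !inE xA andbT negbK => /eqP <-.
Qed.

Lemma rel_face_shrinkW F G A As a w : a \in A ->
  rel_face (F :\: (A :\ a)) (a |: G) As w -> rel_face F G (A :: As) w.
Proof. by move=> aA Qw; rewrite -(@rel_face_shrink _ _ _ _ a) //; case/andP: Qw. Qed.

(* As partitions F \ G; in the step one element a of the first block moves to G
   and the other elements of that block are discarded. *)
Definition fills F G As :=
  [/\ forall A, A \in As -> A != set0, forall A, A \in As -> A \subset F,
      forall A, A \in As -> [disjoint A & G], disjoint_family As &
      forall x, x \in F -> x \notin G -> exists2 A, A \in As & x \in A].

Lemma fills_shrink F G A As a : a \in A -> fills F G (A :: As) ->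
  [/\ fills (F :\: (A :\ a)) (a |: G) As, a \in F, a \notin G &
      forall B, B \in As -> a \notin B].
Proof.
move=> aA [nz sF dG dj cov].
have /= /andP[/allP dA dj'] := dj.
have BA B x : B \in As -> x \in B -> x \notin A.
  by move=> /dA; rewrite disjoint_sym => /disjointFr H /H->.
have aG : a \notin G by rewrite (disjointFr (dG A (mem_head _ _)) aA).
have aB B : B \in As -> a \notin B by move=> /dA /disjointFr ->.
split=> //; last exact: (subsetP (sF A (mem_head _ _))).
split=> //.
- by move=> B BAs; apply: nz; rewrite inE BAs orbT.
- move=> B BAs; apply/subsetP => x xB; rewrite !inE negb_and (BA B) //= orbT.
  by apply: (subsetP (sF B _)); rewrite // inE BAs orbT.
- move=> B BAs; rewrite disjoints_subset; apply/subsetP => x xB; rewrite !inE.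
  rewrite (disjointFr (dG B _) xB) ?inE ?BAs ?orbT // orbF.
  by apply: contraNneq (aB B BAs) => <-.
- move=> x /setDP[xF]; rewrite in_setD1 in_setU1 negb_and negbK negb_or => xA.
  move=> /andP[/negbTE xa xG]; rewrite {}xa /= in xA.
  have [B] := cov x xF xG; rewrite inE => /predU1P[->|]; first by rewrite (negbTE xA).
  by move=> ? ?; exists B.
Qed.

(** Another element of A in s keeps A met after a is deleted, and a is needed neither for G nor for
    the other blocks. *)
Lemma rel_face_toggle F G A As a s w : a \notin G -> (forall B, B \in As -> a \notin B) ->
  s =i a :: w -> w \subset F ->
  rel_face F G (A :: As) s && has (mem (A :\ a)) s ->
  rel_face F G (A :: As) w && has (mem (A :\ a)) w.
Proof.
move=> aG aB sE wF /andP[/and3P[_ /subsetP Gs /= /andP[_ /allP Bs]]].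
case/hasP => x; rewrite sE inE /= !inE => + /andP[xa xA].
rewrite (negbTE xa) /= => xw; apply/andP; split; last first.
  by apply/hasP; exists x => //=; rewrite !inE xa.
apply/and3P; split=> //.
  apply/subsetP => z zG; have := Gs z zG; rewrite sE inE.
  by case: eqVneq zG aG => // -> ->.
apply/andP; split; first by apply/hasP; exists x.
apply/allP => B BAs; have /hasP[z] := Bs B BAs; rewrite sE inE.
case/predU1P => [->|zw zB]; first by rewrite /= (negbTE (aB B BAs)).
by apply/hasP; exists z.
Qed.

(** Induction on the blocks. A primitive is first found on the faces avoiding A \ a, which have one
    block less and one more element in G; the remainder lives on the faces meeting A \ a, where a
    can be toggled. Without blocks, G = F is the only relative face. *)
Lemma simplex_acyclic As F G i phi : fills F G As -> i != (#|G| + size As)%N ->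
  (forall w, sorted incr w -> w \subset F -> size w = i -> ~~ rel_face F G As w -> phi w = 0) ->
  (forall w, sorted incr w -> w \subset F -> size w = i.+1 -> delta phi w = 0) ->
  exists2 psi, (forall w, ~~ rel_face F G As w -> psi w = 0) &
    forall w, sorted incr w -> w \subset F -> size w = i -> phi w = delta psi w.
Proof.
elim: As F G phi => [|A As IH] F G phi fF ine phi0 phic.
  exists (fun=> 0) => // w sw wF szw; rewrite koszul_d_eq0 //; apply: phi0 => //.
  apply: contra ine => /and3P[_ Gw _]; rewrite -szw addn0 eq_sym.
  rewrite -(card_uniqP (incr_uniq sw)); apply/eqP/eq_card => x.
  apply/idP/idP => [/(subsetP Gw)//|/(subsetP wF) xF].
  by apply/negPn/negP => xG; case: fF => _ _ _ _ /(_ x xF xG)[].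
have [a aA] : exists a, a \in A by apply/set0Pn; case: fF => /(_ A (mem_head _ _)).
have [fF' aF aG aB] := fills_shrink aA fF.
have F'F : F :\: (A :\ a) \subset F := subsetDl _ _.
have [] := IH _ _ phi fF'.
- by rewrite cardsU1 aG add1n addSnnS.
- move=> w sw wF' szw; rewrite rel_face_shrink //; apply: phi0 => //.
  exact: subset_trans F'F.
- by move=> w sw wF' szw; apply: phic => //; apply: subset_trans F'F.
move=> psi1 psi10 psi1E.
have psi1_0 w : ~~ rel_face F G (A :: As) w -> psi1 w = 0.
  by move=> nQ; apply: psi10; apply: contra nQ; apply: rel_face_shrinkW.
pose Q1 w := rel_face F G (A :: As) w && has (mem (A :\ a)) w.
have [|||psi2 psi20 psi2E] := @toggle_acyclic F Q1 a i (fun w => phi w - delta psi1 w) aF.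
- by move=> s w sE _ wF; apply: rel_face_toggle.
- move=> w sw wF szw; rewrite /Q1 negb_and -(subset_setD_setD1 A a wF).
  have [Qw /= wF'|nQ _] := boolP (rel_face _ _ _ w); first by rewrite psi1E // subrr.
  rewrite phi0 // (delta_support psi1_0) ?subrr // => s sw'.
  by apply: contra nQ; apply: rel_face_up => //; apply: subseq_subset.
- by move=> w sw wF szw; rewrite koszul_dB phic // koszul_d_d subrr.
exists (fun w => psi1 w + psi2 w) => [w nQ|w sw wF szw].
  by rewrite psi1_0 // psi20 ?addr0 // /Q1 (negbTE nQ).
by rewrite koszul_dD -psi2E // addrC subrK.
Qed.

(** In the exceptional degree the same induction builds a cocycle. The differential of the cocycle
    on F \ (A \ a) lives on faces meeting A \ a; toggling a yields a correction supported on such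
    faces, which leaves the value at w0 unchanged. *)
Lemma simplex_class As F G : fills F G As -> G \subset F ->
  exists phi w0, [/\ forall w, ~~ rel_face F G As w -> phi w = 0,
    forall w, sorted incr w -> w \subset F -> size w = (#|G| + size As).+1 ->
      delta phi w = 0,
    sorted incr w0 /\ w0 \subset F, size w0 = (#|G| + size As)%N & phi w0 = 1].
Proof.
elim: As F G => [|A As IH] F G fF GF.
  exists (fun w => (w == enum G)%:R), (enum G); split.
  - move=> w; case: eqP => // -> /negP[]; apply/and3P; split=> //.
      by apply/subsetP => x; rewrite mem_enum; apply: (subsetP GF).
    by apply/subsetP => x; rewrite mem_enum.
  - move=> w sw wF; rewrite addn0 => szw; have: (size w <= #|G|)%N.
      rewrite -(card_uniqP (incr_uniq sw)); apply: subset_leq_card.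
      apply/subsetP => x /(subsetP wF) xF.
      by apply/negPn/negP => xG; case: fF => _ _ _ _ /(_ x xF xG)[].
    by rewrite szw ltnn.
  - split; last by apply/subsetP => x; rewrite mem_enum; apply: (subsetP GF).
    rewrite /enum_mem; apply: sorted_filter; first exact: incr_trans.
    rewrite -enumT; have := iota_ltn_sorted 0 N; rewrite -val_enum_ord.
    by rewrite sorted_map.
  - by rewrite -cardE addn0.
  - by rewrite eqxx.
have [a aA] : exists a, a \in A by apply/set0Pn; case: fF => /(_ A (mem_head _ _)).
have [fF' aF aG aB] := fills_shrink aA fF.
have [|phi [w0 [phi0 phic [sw0 w0F'] szw0 phiw0]]] := IH _ _ fF'.
  rewrite subUset sub1set !inE aF eqxx /=; apply/subsetP => x xG.
  rewrite !inE (subsetP GF) // negb_and negbK andbT.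
  by case: fF => _ _ /(_ A (mem_head _ _))/disjointFl/(_ xG)->; rewrite orbT.
have F'F : F :\: (A :\ a) \subset F := subsetDl _ _.
have eE : (#|a |: G| + size As = #|G| + size (A :: As))%N.
  by rewrite cardsU1 aG add1n addSnnS.
rewrite {}eE in szw0 phic.
have phi_0 w : ~~ rel_face F G (A :: As) w -> phi w = 0.
  by move=> nQ; apply: phi0; apply: contra nQ; apply: rel_face_shrinkW.
pose Q1 w := rel_face F G (A :: As) w && has (mem (A :\ a)) w.
have [|||psi psi0 psiE] :=
  @toggle_acyclic F Q1 a (#|G| + size (A :: As)).+1 (delta phi) aF.
- by move=> s w sE _ wF; apply: rel_face_toggle.
- move=> w sw wF szw; rewrite /Q1 negb_and -(subset_setD_setD1 A a wF).
  have [Qw /= wF'|nQ _] := boolP (rel_face _ _ _ w); first exact: phic.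
  apply: (delta_support phi_0) => s sw'.
  by apply: contra nQ; apply: rel_face_up => //; apply: subseq_subset.
- by move=> w _ _ _; apply: koszul_d_d.
exists (fun w => phi w - psi w), w0; split=> //.
- by move=> w nQ; rewrite phi_0 // psi0 ?subrr // /Q1 (negbTE nQ).
- by move=> w sw wF szw; rewrite koszul_dB psiE ?subrr.
- by split=> //; apply: subset_trans F'F.
rewrite psi0 ?subr0 // /Q1 negb_and.
by rewrite -(subset_setD_setD1 A a (subset_trans w0F' F'F)) w0F' orbT.
Qed.

(** A relative face contains G and a point of each block, and these are distinct by disjointness. *)
Lemma rel_face_size As F G w : fills F G As -> rel_face F G As w ->
  (#|G| + size As <= size w)%N.
Proof.
case=> _ _ dG dj _ /and3P[_ Gw]; elim: As dG dj w Gw => [|A As IH] dG dj w Gw.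
  by rewrite addn0 => _; apply: leq_trans (card_size w); apply: subset_leq_card.
have /= /andP[/allP dA dj'] := dj.
move=> /andP[hasA /allP hasAs]; rewrite -(count_predC (mem A) w) /= addnS -add1n.
apply: leq_add; first by rewrite -has_count.
rewrite -size_filter; apply: IH => //.
- by move=> B BAs; apply: dG; rewrite inE BAs orbT.
- apply/subsetP => x xG; rewrite mem_filter (subsetP Gw) // andbT /=.
  by rewrite (disjointFl (dG A (mem_head _ _)) xG).
- apply/allP => B BAs; have /hasP[x xw xB] := hasAs B BAs.
  apply/hasP; exists x => //; rewrite mem_filter xw andbT /=.
  by rewrite (disjointFl (dA B BAs)).
Qed.

Lemma fills_card As F G k : fills F G As -> G \subset F ->
  (forall A, A \in As -> #|A| = k) -> (#|G| + size As * k)%N = #|F|.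
Proof.
elim: As F => [|A As IH] F [nz sF dG dj cov] GF Ak.
  rewrite addn0; apply: eq_card => x; apply/idP/idP => [/(subsetP GF)//|xF].
  by apply/negPn/negP => /(cov x xF)[].
have /= /andP[/allP dA dj'] := dj.
rewrite -(cardsID A F) (setIidPr (sF A (mem_head _ _))) Ak ?mem_head //.
rewrite mulSn addnCA (IH (F :\: A)) //.
- split=> //.
  + by move=> B BAs; apply: nz; rewrite inE BAs orbT.
  + move=> B BAs; rewrite subsetD disjoint_sym dA // sF // inE BAs orbT //.
  + by move=> B BAs; apply: dG; rewrite inE BAs orbT.
  + move=> x /setDP[xF xA] xG; have [B] := cov x xF xG.
    by rewrite inE => /predU1P[->|]; [rewrite (negbTE xA) | exists B].
- by rewrite subsetD GF disjoint_sym dG ?mem_head.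
- by move=> B BAs; apply: Ak; rewrite inE BAs orbT.
Qed.
End RelativeSimplex.

(** * Cohomology along the shelling *)

Section BlockShelling.
Variable N : nat.
Implicit Types (F G A B : {set 'I_N}) (s : seq {set 'I_N}).

(* The facets s_0, s_1, .. have d elements, and the intersection of s_j with the
   complex of its predecessors is generated by the sets s_j \ A with A in As j,
   which are pairwise disjoint k-sets. *)
Definition block_shelling d k s (As : nat -> seq {set 'I_N}) : Prop :=
  (forall F, F \in s -> #|F| = d) /\
  forall j, (j < size s)%N -> let F := nth set0 s j in
    [/\ disjoint_family (As j), forall A, A \in As j -> A \subset F,
        forall A, A \in As j -> #|A| = k &
        forall w : {set 'I_N}, w \subset F ->
          has (fun F' => w \subset F') (take j s) =
          ~~ all (fun A => ~~ [disjoint A & w]) (As j)].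

Definition block_core s (As : nat -> seq {set 'I_N}) j : {set 'I_N} :=
  [set x in nth set0 s j | all (fun A => x \notin A) (As j)].

Variables (d k : nat) (s : seq {set 'I_N}) (As : nat -> seq {set 'I_N}).
Hypothesis k_gt0 : (0 < k)%N.
Hypothesis shell : block_shelling d k s As.

Lemma block_fills j : (j < size s)%N ->
  fills (nth set0 s j) (block_core s As j) (As j).
Proof.
case: shell => _ sh /sh[dj sF Ak _]; split=> //.
- by move=> A AAs; rewrite -card_gt0 Ak.
- move=> A AAs; rewrite disjoints_subset; apply/subsetP => x xA.
  by rewrite !inE negb_and -has_predC; apply/orP; right; apply/hasP; exists A; rewrite //= xA.
- move=> x xF; rewrite inE xF -has_predC => /hasP[A AAs] /=.
  by rewrite negbK => xA; exists A.
Qed.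

Lemma block_core_card j : (j < size s)%N ->
  (#|block_core s As j| + size (As j) * k)%N = d.
Proof.
move=> jlt; case: shell => sd sh; rewrite -(sd (nth set0 s j)) ?mem_nth //.
apply: (fills_card (block_fills jlt)); last by case: (sh j jlt).
by apply/subsetP => x; rewrite inE => /andP[].
Qed.

Variable R : comNzRingType.
Implicit Types (phi psi : seq 'I_N -> R) (w : seq 'I_N).
Local Notation delta := (koszul_d (fun=> 1 : R)).

Definition stage m w := has (fun F => w \subset F) (take m s).

Lemma stageS m w : (m < size s)%N ->
  stage m.+1 w = stage m w || (w \subset nth set0 s m).
Proof. by move=> mlt; rewrite /stage (take_nth set0 mlt) has_rcons orbC. Qed.

Lemma stage_sub m u w : u \subset w -> stage m w -> stage m u.
Proof.
move=> uw /hasP[F Fs wF]; apply/hasP; exists F => //; exact: subset_trans wF.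
Qed.

(** By the shelling condition, a subset of F_m is new exactly when it meets every block of F_m. *)
Lemma stage_rel_face m G w : (m < size s)%N -> w \subset nth set0 s m ->
  rel_face (nth set0 s m) G (As m) w = (G \subset w) && ~~ stage m w.
Proof.
move=> mlt wF; rewrite /rel_face wF /=; congr (_ && _).
have eqw F : ([set x in w] \subset F) = (w \subset F).
  by apply: eq_subset => x; rewrite inE.
case: shell => _ /(_ m mlt)[_ _ _ /(_ [set x in w])]; rewrite eqw => /(_ wF).
rewrite /stage (eq_has (a2 := fun F => w \subset F)) // => ->; rewrite negbK.
apply: eq_all => A; rewrite -setI_eq0.
apply/hasP/set0Pn => -[x]; first by exists x; rewrite !inE; apply/andP.
by rewrite !inE => /andP[xA xw]; exists x.
Qed.

Lemma rel_face_stage m G w : (m < size s)%N ->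
  rel_face (nth set0 s m) G (As m) w -> ~~ stage m w.
Proof.
move=> mlt Qw; have /andP[wF _] := Qw.
by move: Qw; rewrite stage_rel_face // => /andP[].
Qed.

Section Core.
Variables (G : {set 'I_N}) (t : nat).
Hypothesis Gt : (#|G| + t * k)%N = d.

(** Attaching any facet can change the cohomology above G in one degree only, and purity makes this
    degree the same for all facets. *)
Lemma rel_acyclic m i phi : (m < size s)%N -> i != (#|G| + t)%N ->
  let F := nth set0 s m in let Q := rel_face F G (As m) in
  (forall w, sorted incr w -> w \subset F -> size w = i -> ~~ Q w -> phi w = 0) ->
  (forall w, sorted incr w -> w \subset F -> size w = i.+1 -> delta phi w = 0) ->
  exists2 psi, (forall w, ~~ Q w -> psi w = 0) &
    forall w, sorted incr w -> w \subset F -> size w = i -> phi w = delta psi w.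
Proof.
move=> mlt ine F Q phi0 phic; have [dj sF Ak _] := shell.2 m mlt.
have [GF|GF] := boolP (G \subset F); last first.
  exists (fun=> 0) => // w sw wF szw; rewrite koszul_d_eq0 //; apply: phi0 => //.
  by apply: contra GF => /and3P[_ Gw _]; apply: subset_trans wF.
(* If all blocks through some v outside G already meet G, then v can be deleted from a new face
   above G, and toggling v applies. *)
have [|nofree] := boolP [exists v in F, (v \notin G) &&
    all (fun A : {set 'I_N} => (v \in A) ==> ~~ [disjoint A & G]) (As m)].
  case/exists_inP => v vF /andP[vG /allP vA].
  apply: (@toggle_acyclic _ _ F Q v) => // u w uE vw wF /and3P[_ /subsetP Gu /allP Au].
  have Gw : G \subset w.
    apply/subsetP => x xG; have := Gu x xG; rewrite uE inE.
    by case: eqVneq xG vG => // -> ->.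
  apply/and3P; split=> //; apply/allP => A AAs.
  have /hasP[x] := Au A AAs; rewrite uE inE => /predU1P[->|xw] /= xA; last first.
    by apply/hasP; exists x.
  have := vA A AAs; rewrite xA /= -setI_eq0 => /set0Pn[y]; rewrite inE => /andP[yA yG].
  by apply/hasP; exists y => //; apply: (subsetP Gw).
(* Otherwise the blocks disjoint from G cover F \ G; the blocks meeting G impose nothing on faces
   above G. Counting elements of F with [Gt] shows that t blocks remain. *)
pose As' := [seq A : {set 'I_N} <- As m | [disjoint A & G]].
have fF : fills F G As'.
  split.
  - by move=> A; rewrite mem_filter => /andP[_ /Ak AK]; rewrite -card_gt0 AK.
  - by move=> A; rewrite mem_filter => /andP[_ /sF].
  - by move=> A; rewrite mem_filter => /andP[].
  - exact: (subseq_pairwise (filter_subseq _ _)).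
  - move=> x xF xG; move: nofree; rewrite negb_exists_in => /forall_inP/(_ x xF).
    rewrite xG /= -has_predC => /hasP[A AAs] /=; rewrite negb_imply negbK.
    by move=> /andP[xA dA]; exists A; rewrite // mem_filter dA.
have szAs : size As' = t.
  apply/eqP; rewrite -(eqn_pmul2r k_gt0) -(eqn_add2l #|G|) Gt.
  rewrite (fills_card fF GF); last by move=> A; rewrite mem_filter => /andP[_ /Ak].
  by rewrite (shell.1 F) ?mem_nth.
have QE w : Q w = rel_face F G As' w.
  rewrite /Q /rel_face; case: (w \subset F) => //=; have [Gw|//] := boolP (G \subset w).
  rewrite /= all_filter; apply: eq_in_all => A AAs /=.
  have [//|] := boolP [disjoint A & G]; rewrite -setI_eq0 => /set0Pn[y].
  rewrite inE => /andP[yA yG]; apply/hasP; exists y => //; exact: (subsetP Gw).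
have [|||psi psi0 psiE] := @simplex_acyclic _ _ As' F G i phi fF.
- by rewrite szAs.
- by move=> w sw wF szw; rewrite -QE; apply: phi0.
- by [].
by exists psi => // w; rewrite QE; apply: psi0.
Qed.

Definition stage_cocycle m i phi :=
  forall w, sorted incr w -> stage m w -> size w = i.+1 -> delta phi w = 0.
Definition supported_above phi := forall w, ~~ (G \subset w) -> phi w = 0.

Lemma delta_above phi w : supported_above phi -> ~~ (G \subset w) -> delta phi w = 0.
Proof.
move=> phi0 Gw; apply: (delta_support (Q := fun u => G \subset u)) => // u uw.
by apply: contra Gw => /subset_trans; apply; apply: subseq_subset.
Qed.

Lemma rel_face_above m psi : (forall w, ~~ rel_face (nth set0 s m) G (As m) w -> psi w = 0) ->
  supported_above psi.
Proof. by move=> psi0 w Gw; apply: psi0; apply: contra Gw => /and3P[]. Qed.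

Lemma delta_stage m psi w : (m < size s)%N ->
  (forall w, ~~ rel_face (nth set0 s m) G (As m) w -> psi w = 0) ->
  stage m w -> delta psi w = 0.
Proof.
move=> mlt psi0 mw; apply: (delta_support psi0) => u uw.
apply/negP => /(rel_face_stage mlt)/negP; apply; apply: stage_sub mw.
exact: subseq_subset.
Qed.

(** The exact sequence of a pair on cochains: after a primitive on the earlier facets is subtracted,
    the remainder on F_m is supported on the new faces. *)
Lemma stage_acyclic m i phi : (m <= size s)%N -> i != (#|G| + t)%N ->
  supported_above phi -> stage_cocycle m i phi ->
  exists2 psi, supported_above psi &
    forall w, sorted incr w -> stage m w -> size w = i -> phi w = delta psi w.
Proof.
move=> + ine phi0; elim: m => [_ _|m IH mlt phic].
  by exists (fun=> 0) => // w _; rewrite /stage take0.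
have [||psi psi0 psiE] := IH; first exact: ltnW.
  by move=> w sw mw; apply: phic => //; rewrite stageS // mw.
have [||psi2 psi20 psi2E] := @rel_acyclic m i (fun w => phi w - delta psi w) mlt ine.
- move=> w sw wF szw; rewrite stage_rel_face // negb_and negbK => /orP[Gw|mw].
    by rewrite phi0 // delta_above // subrr.
  by rewrite psiE // subrr.
- move=> w sw wF szw; rewrite koszul_dB koszul_d_d subr0; apply: phic => //.
  by rewrite stageS // wF orbT.
exists (fun w => psi w + psi2 w) => [w Gw|w sw mw szw].
  by rewrite psi0 // (rel_face_above psi20) // addr0.
rewrite koszul_dD; move: mw; rewrite stageS // => /orP[mw|wF].
  by rewrite -psiE // (delta_stage mlt psi20 mw) addr0.
by rewrite -psi2E // addrC subrK.
Qed.

(** The obstruction to extending the cocycle over F_m is a relative class in degree |G| + t + 1,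
    where the relative cohomology vanishes. *)
Lemma stage_lift m phi : (m < size s)%N ->
  supported_above phi -> stage_cocycle m (#|G| + t) phi ->
  exists phi', [/\ supported_above phi', stage_cocycle m.+1 (#|G| + t) phi' &
    forall w, stage m w -> phi' w = phi w].
Proof.
move=> mlt phi0 phic; pose phi1 w := if stage m w then phi w else 0.
have phi10 : supported_above phi1 by move=> w Gw; rewrite /phi1 phi0 ?if_same.
have phi1c : stage_cocycle m (#|G| + t) phi1.
  move=> w sw mw szw; rewrite -(phic w) //; apply: koszul_d_ext => u uw _.
  by rewrite /phi1 (stage_sub _ mw) // subseq_subset.
have [|||psi psi0 psiE] := @rel_acyclic m (#|G| + t).+1 (delta phi1) mlt.
- by rewrite gtn_eqF.
- move=> w sw wF szw; rewrite stage_rel_face // negb_and negbK => /orP[Gw|mw].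
    exact: delta_above.
  exact: phi1c.
- by move=> w _ _ _; apply: koszul_d_d.
exists (fun w => phi1 w - psi w); split=> [w Gw|w sw mw szw|w mw].
- by rewrite phi10 // (rel_face_above psi0) // subrr.
- rewrite koszul_dB; move: mw; rewrite stageS // => /orP[mw|wF].
    by rewrite phi1c // (delta_stage mlt psi0 mw) subrr.
  by rewrite psiE // subrr.
- rewrite /phi1 mw psi0 ?subr0 //; apply/negP => /(rel_face_stage mlt).
  by rewrite mw.
Qed.

Lemma stage_lift_iter m n phi : (m <= n)%N -> (n <= size s)%N ->
  supported_above phi -> stage_cocycle m (#|G| + t) phi ->
  exists phi', [/\ supported_above phi', stage_cocycle n (#|G| + t) phi' &
    forall w, stage m w -> phi' w = phi w].
Proof.
elim: n => [|n IH]; first by rewrite leqn0 => /eqP-> _ ? ?; exists phi.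
rewrite leq_eqVlt => /predU1P[-> _ ? ?|mle nlt phi0 phic]; first by exists phi.
have [phi1 [phi10 phi1c phi1E]] := IH mle (ltnW nlt) phi0 phic.
have [phi2 [phi20 phi2c phi2E]] := stage_lift nlt phi10 phi1c.
exists phi2; split=> // w mw; rewrite phi2E ?phi1E //.
move/hasP: mw => [F Fs wF]; apply/hasP; exists F => //.
by move: Fs; rewrite -(take_takel s (mle : (m <= n)%N)); apply: mem_take.
Qed.
End Core.

(** The class created by F_j is lifted to the whole complex. A primitive psi would be a cocycle
    before F_j, where phi0 vanishes, hence some delta chi there. New faces of F_j above G have at
    least e elements, so psi - delta chi vanishes on the subfaces of w0 of size e - 1, against the
    value 1 at w0. *)
Lemma shelling_class j : (j < size s)%N ->
  let G := block_core s As j in let e := (#|G| + size (As j))%N in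
  exists phi, [/\ supported_above G phi, stage_cocycle (size s) e phi &
    forall psi, supported_above G psi ->
      ~ (forall w, sorted incr w -> stage (size s) w -> size w = e -> phi w = delta psi w)].
Proof.
move=> jlt G e; have fF := block_fills jlt.
have Gt := block_core_card jlt.
have GF : G \subset nth set0 s j by apply/subsetP => x; rewrite inE => /andP[].
have [phi0 [w0 [phi00 phi0c [sw0 w0F] szw0 phi0w0]]] := simplex_class R fF GF.
have phi0c' : stage_cocycle j.+1 e phi0.
  move=> w sw mw szw; move: mw; rewrite stageS // => /orP[mw|wF].
    exact: (delta_stage jlt phi00).
  exact: phi0c.
have [phi [phiG phic phiE]] := stage_lift_iter Gt jlt (leqnn _) (rel_face_above phi00) phi0c'.
exists phi; split=> // psi psi0 psiE.
have up w : stage j.+1 w -> stage (size s) w.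
  move=> /hasP[F Fs wF]; apply/hasP; exists F => //.
  by rewrite take_size; apply: mem_take Fs.
have psiE0 w : sorted incr w -> stage j.+1 w -> size w = e -> phi0 w = delta psi w.
  by move=> sw mw szw; rewrite -psiE ?phiE //; apply: up.
have w0st : stage j.+1 w0 by rewrite stageS // w0F orbT.
have := psiE0 w0 sw0 w0st szw0; rewrite phi0w0.
(* For e = 0 the face w0 is empty, and every coboundary vanishes on it. *)
have [e0|/prednK/esym eE] := posnP e.
  by move: szw0; rewrite -/e e0 => /size0nil-> /eqP; rewrite /= oner_eq0.
have [|||chi chi0 chiE] := @stage_acyclic G _ Gt j e.-1 psi (ltnW jlt).
- by rewrite -/e [in X in _ != X]eE neq_ltn ltnSn.
- exact: psi0.
- move=> w sw mw szw; rewrite -psiE0 ?stageS ?mw ?szw //.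
  by apply: phi00; apply/negP => /(rel_face_stage jlt); rewrite mw.
rewrite -[delta psi w0]subr0 -(koszul_d_d (fun=> 1) chi w0) -koszul_dB koszul_d_eq0; last first.
  move=> u uw szu; have su := incr_subseq uw sw0.
  have uF := subset_trans (subseq_subset uw) w0F.
  have [Gu|Gu] := boolP (G \subset u); last by rewrite psi0 // (delta_above (G := G)) // subrr.
  have [ju|ju] := boolP (stage j u).
    by rewrite chiE ?subrr // -(succnK (size u)) szu szw0.
  have Qu : rel_face (nth set0 s j) G (As j) u by rewrite stage_rel_face // Gu.
  by have := rel_face_size fF Qu; rewrite -szw0 -szu ltnn.
by move/eqP; rewrite oner_eq0.
Qed.
End BlockShelling.

(** * Stanley decompositions from interval partitions *)

Section IntervalPartition.
Variables (K : fieldType) (N : nat) (face : pred {set 'I_N}).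
Hypothesis face_sub : forall A B : {set 'I_N}, A \subset B -> face B -> face A.
Variable Gm : 'X_{1..N} -> Prop.
Hypothesis Gm_nonface : forall m, Gm m -> ~~ face (supp m).
Hypothesis nonface_Gm : forall m, ~~ face (supp m) -> exists2 u, Gm u & lem u m.
Local Notation P := {mpoly K[N]}.
Local Notation I := (in_ideal (@mon_gens K N Gm)).

(** [rho w] is the bottom of the interval containing w, and [Z T] the top of the interval with
    bottom T. *)
Variables rho Z : {set 'I_N} -> {set 'I_N}.
Hypothesis rho_Z : forall w : {set 'I_N}, face w -> (rho w \subset w) && (w \subset Z (rho w)).
Hypothesis rho_interval : forall w0 w : {set 'I_N}, face w0 ->
  rho w0 \subset w -> w \subset Z (rho w0) -> face w /\ rho w = rho w0.

Let mon (T : {set 'I_N}) : 'X_{1..N} := [multinom (v \in T : nat) | v < N].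

Let lem_mon T m : lem (mon T) m = (T \subset supp m).
Proof.
apply/mnm_lepP/subsetP => H v; have := H v; rewrite mnmE inE -lt0n.
  by move=> + vT; rewrite vT.
by case: (v \in T) => // /(_ isT).
Qed.

(** The monomials of x_T K[Z T] have their support in the interval of T, so distinct intervals give
    Stanley spaces with no common monomial. *)
Let mcoeff_part T (p : P) m : face T -> rho T = T -> in_KZ (Z T) p ->
  ('X_[mon T] * p)@_m != 0 -> face (supp m) /\ rho (supp m) = T.
Proof.
move=> fT rT pZ; rewrite mcoeffXM lem_mon; case: ifP => [Tm|]; last by rewrite eqxx.
rewrite -mcoeff_msupp => /pZ mZ; rewrite -[in RHS]rT; apply: rho_interval => //.
  by rewrite rT.
apply/subsetP => v; rewrite inE rT => mv; apply/negPn/negP => vZ.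
have := mZ v vZ; rewrite mnmBE mnmE; case: (boolP (v \in T)) => [vT _|_]; last first.
  by rewrite subn0 => m0; rewrite m0 in mv.
by case/andP: (rho_Z fT); rewrite rT => _ /subsetP/(_ v vT); apply/negP.
Qed.

(* The partition of the complex into the intervals [rho w, Z (rho w)] yields the
   Stanley spaces x_T K[Z T], T = rho w. *)
Lemma interval_sdepth d0 : (forall w : {set 'I_N}, face w -> (d0 <= #|Z (rho w)|)%N) ->
  sdepth_ge (@mon_gens K N Gm) d0.
Proof.
move=> d0Z; pose Ts : {set {set 'I_N}} := rho @: [set w : {set 'I_N} | face w].
have TsP T : T \in Ts -> [/\ face T, rho T = T & (d0 <= #|Z T|)%N].
  case/imsetP => w; rewrite inE => fw ->; have /andP[Tw wZ] := rho_Z fw.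
  have [] := rho_interval fw (subxx _) (subset_trans Tw wZ).
  by split=> //; apply: d0Z.
have memI := @in_face_ideal K _ _ face_sub _ Gm_nonface nonface_Gm.
pose T (i : 'I_#|Ts|) : {set 'I_N} := enum_val i.
have TT i : T i \in Ts := enum_valP i.
exists #|Ts|, (fun i => 'X_[mon (T i)]), (fun i => Z (T i)).
have part i (p : P) m : in_KZ (Z (T i)) p -> face (supp m) ->
    rho (supp m) != T i -> ('X_[mon (T i)] * p)@_m = 0.
  move=> pZ fm rm; have [fT rT _] := TsP _ (TT i).
  by apply/eqP/(contraNT _ rm) => /(mcoeff_part fT rT pZ)[_ ->].
have sum_part (ps : 'I_#|Ts| -> P) i m : (forall i, in_KZ (Z (T i)) (ps i)) ->
    face (supp m) -> rho (supp m) = T i ->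
    (\sum_(i < #|Ts|) 'X_[mon (T i)] * ps i)@_m = ('X_[mon (T i)] * ps i)@_m.
  move=> psZ fm rm; rewrite raddf_sum (bigD1 i) //= big1 ?addr0 // => j ji.
  by apply: part => //; rewrite rm; apply: contra ji => /eqP/enum_val_inj->.
have rank m : face (supp m) -> exists i, rho (supp m) = T i.
  move=> fm; have rTs : rho (supp m) \in Ts by apply: imset_f; rewrite inE.
  by exists (enum_rank_in rTs (rho (supp m))); rewrite /T enum_rankK_in.
split; last by move=> i; case: (TsP _ (TT i)).
split; [|split].
- move=> i; have [fT rT _] := TsP _ (TT i); split.
    by exists 1, (mon (T i)); rewrite scale1r.
  move=> p pZ /memI p0; apply/mpolyP => m; rewrite mcoeff0.
  apply/eqP/negPn/negP => pm.
  have : ('X_[mon (T i)] * p)@_(m + mon (T i)) = p@_m.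
    by rewrite mcoeffXM lem_addl addmK.
  move=> pE; have := pm; rewrite -pE => /(mcoeff_part fT rT pZ)[fm _].
  by move: pm; rewrite -pE p0 ?eqxx.
(* The terms of f are sorted by the interval of their support, and each is divided by x_T; terms
   with nonface support vanish modulo the ideal. *)
- move=> f; pose sel i m := face (supp m) && (rho (supp m) == T i).
  pose ps i : P := \sum_(m <- msupp f | sel i m) f@_m *: 'X_[m - mon (T i)].
  have psZ i : in_KZ (Z (T i)) (ps i).
    move=> m; rewrite mcoeff_msupp => pm v vZ; apply/eqP; apply: contraNT pm => mv.
    rewrite raddf_sum big1 // => m' /andP[fm' /eqP rm'] /=.
    rewrite mcoeffZ mcoeffX; case: eqP => [mE|]; last by rewrite mulr0.
    case/negP: vZ; rewrite -rm'; have /andP[_ /subsetP] := rho_Z fm'; apply.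
    by rewrite inE; apply: contraNneq mv => m'v; rewrite -mE mnmBE m'v.
  have psE i : 'X_[mon (T i)] * ps i = \sum_(m <- msupp f | sel i m) f@_m *: 'X_[m].
    rewrite mulr_sumr; apply: eq_bigr => m /andP[fm /eqP rm].
    rewrite -scalerAr -mpolyXD addmC submK // lem_mon -rm.
    by case/andP: (rho_Z fm).
  exists ps; split=> //; apply/memI => m fm; have [i ri] := rank m fm.
  rewrite mcoeffB (sum_part _ i) // psE; apply/eqP; rewrite subr_eq0; apply/eqP.
  rewrite [in LHS](mpolyE f) !raddf_sum /= [RHS]big_mkcond /=.
  apply: eq_bigr => m' _; case: ifP => // /negP sm'.
  rewrite mcoeffZ mcoeffX; case: eqP => [mE|]; last by rewrite mulr0.
  by case: sm'; rewrite /sel mE fm ri eqxx.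
- move=> ps psZ /memI ps0 i; apply/memI => m fm.
  have [rm|/part->//] := eqVneq (rho (supp m)) (T i).
  by rewrite -(sum_part ps) // ps0.
Qed.
End IntervalPartition.

Lemma card_bigcup_seq_leq (T : finType) (I : eqType) (r : seq I) (F : I -> {set T}) c :
  (forall i, i \in r -> (#|F i| <= c)%N) -> (#|\bigcup_(i <- r) F i| <= size r * c)%N.
Proof.
elim: r => [|i r IH] Fc; first by rewrite big_nil cards0.
rewrite big_cons mulSn; apply: leq_trans (leq_card_setU _ _) _.
apply: leq_add; first by apply: Fc; rewrite mem_head.
by apply: IH => j jr; apply: Fc; rewrite inE jr orbT.
Qed.

(** * The interval partition of a block shelling *)

Section BlockPartition.
Variables (N d k : nat) (s : seq {set 'I_N}) (As : nat -> seq {set 'I_N}).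
Hypothesis shell : block_shelling d k s As.
Implicit Types (w T A : {set 'I_N}).

Definition covered w := has (fun F : {set 'I_N} => w \subset F) s.
Definition first_facet w := find (fun F : {set 'I_N} => w \subset F) s.
Definition block_min w A (a : 'I_N) :=
  (a \in A) && [forall b in w, (b \in A) ==> (a <= b)%N].
Definition block_mins w :=
  [set a in w | has (fun A : {set 'I_N} => block_min w A a) (As (first_facet w))].
(** The top of the interval with bottom T: the facet without the elements that would lower the
    minimum of some block. *)
Definition block_tails T := [set b in nth set0 s (first_facet T) |
  all (fun A : {set 'I_N} => (b \in A) ==> [exists a in T, (a \in A) && (a <= b)%N])
    (As (first_facet T))].

Lemma covered_first w : covered w -> let j := first_facet w in
  [/\ (j < size s)%N, w \subset nth set0 s j &
     forall A, A \in As j -> exists2 x, x \in w & x \in A].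
Proof.
move=> cw j; have jlt : (j < size s)%N by rewrite -has_find.
have wF : w \subset nth set0 s j := nth_find set0 cw.
split=> // A AAs; have [_ _ _ /(_ w wF)] := shell.2 j jlt.
rewrite (_ : has _ _ = false); last first.
  apply/(has_nthP set0) => -[i]; rewrite size_take jlt => ij.
  by rewrite nth_take // (before_find set0 ij).
move/esym/negbFE/allP/(_ A AAs); rewrite -setI_eq0 => /set0Pn[x].
by rewrite inE => /andP[xA xw]; exists x.
Qed.

Lemma first_facet_eq j w : (j < size s)%N -> w \subset nth set0 s j ->
  (forall A, A \in As j -> exists2 x, x \in w & x \in A) ->
  covered w /\ first_facet w = j.
Proof.
move=> jlt wF meet; split; first by apply/hasP; exists (nth set0 s j); rewrite ?mem_nth.
rewrite /first_facet -(cat_take_drop j s) find_cat (drop_nth set0 jlt) /= wF.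
have [_ _ _ /(_ w wF)->] := shell.2 j jlt.
rewrite ifF ?size_take ?jlt ?addn0 //; apply/negbTE; rewrite negbK; apply/allP => A AAs.
have [x xw xA] := meet A AAs; rewrite -setI_eq0; apply/set0Pn; exists x.
by rewrite inE xA.
Qed.

Lemma block_min_exists w A x : x \in w -> x \in A ->
  exists2 a, a \in w & block_min w A a.
Proof.
move=> xw xA; have xwA : (x \in w) && (x \in A) by rewrite xw.
case: (@arg_minnP _ x (fun a => (a \in w) && (a \in A)) val xwA) => a.
move=> /andP[aw aA] amin; exists a => //; rewrite /block_min aA.
by apply/forall_inP => b bw; apply/implyP => bA; apply: amin; rewrite bw.
Qed.

Lemma block_mins_meet w A : covered w -> A \in As (first_facet w) ->
  exists2 a, a \in block_mins w & block_min w A a.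
Proof.
move=> cw AAs; have [_ _ /(_ A AAs)[x xw xA]] := covered_first cw.
have [a aw aA] := block_min_exists xw xA; exists a => //.
by rewrite inE aw; apply/hasP; exists A.
Qed.

Lemma block_mins_sub w : block_mins w \subset w.
Proof. by apply/subsetP => a; rewrite inE => /andP[]. Qed.

Lemma first_facet_mins w : covered w -> first_facet (block_mins w) = first_facet w.
Proof.
move=> cw; have [jlt wF _] := covered_first cw.
have [|A /(block_mins_meet cw)[a aw /andP[aA _]]|_ -> //] :=
  @first_facet_eq (first_facet w) (block_mins w) jlt.
  exact: subset_trans (block_mins_sub w) wF.
by exists a.
Qed.

Lemma block_interval_mem w : covered w ->
  (block_mins w \subset w) && (w \subset block_tails (block_mins w)).
Proof.
move=> cw; rewrite block_mins_sub; apply/subsetP => b bw.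
have [_ /subsetP wF _] := covered_first cw.
rewrite inE first_facet_mins // wF //; apply/allP => A AAs; apply/implyP => bA.
have [a am /andP[aA /forall_inP/(_ b bw)/implyP/(_ bA) ab]] := block_mins_meet cw AAs.
by apply/exists_inP; exists a; rewrite // aA.
Qed.

(** A set above the minima of w0 meets every block, so its first facet is the same; inside the
    tails, no block acquires a smaller minimum. *)
Lemma block_interval w0 w : covered w0 ->
  block_mins w0 \subset w -> w \subset block_tails (block_mins w0) ->
  covered w /\ block_mins w = block_mins w0.
Proof.
move=> cw0 Tw wZ; have [jlt wF meet] := covered_first cw0.
have Zw b : b \in w -> (b \in nth set0 s (first_facet w0)) /\
    forall A, A \in As (first_facet w0) -> b \in A ->
      exists2 a, a \in block_mins w0 & (a \in A) && (a <= b)%N.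
  move/(subsetP wZ); rewrite inE first_facet_mins // => /andP[bF /allP bA].
  by split=> // A AAs bA'; have := bA A AAs; rewrite bA' => /exists_inP.
have [|A AAs|cw jw] := @first_facet_eq (first_facet w0) w jlt.
- by apply/subsetP => b /Zw[].
- have [a aT /andP[aA _]] := block_mins_meet cw0 AAs.
  by exists a; rewrite ?(subsetP Tw).
split=> //; apply/setP => a; apply/idP/idP.
  rewrite inE jw => /andP[aw /hasP[A AAs /andP[aA /forall_inP amin]]].
  have [_ /(_ A AAs aA)[a' aT' /andP[aA' le_a'a]]] := Zw a aw.
  have /implyP/(_ aA') le_aa' := amin a' (subsetP Tw a' aT').
  by rewrite (_ : a = a') //; apply/val_inj/anti_leq; rewrite le_aa'.
move=> aT; rewrite inE (subsetP Tw) // jw.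
have := aT; rewrite inE => /andP[aw0 /hasP[A AAs /andP[aA /forall_inP amin]]].
apply/hasP; exists A => //; rewrite /block_min aA; apply/forall_inP => b bw.
apply/implyP => bA; have [_ /(_ A AAs bA)[a' aT' /andP[aA' le_a'b]]] := Zw b bw.
apply: leq_trans le_a'b; have := amin a' (subsetP (block_mins_sub w0) a' aT').
by rewrite aA'.
Qed.

(** Each block keeps its minimum, so it loses at most k - 1 elements. *)
Lemma block_tails_card w : covered w ->
  (d <= #|block_tails (block_mins w)| + size (As (first_facet w)) * k.-1)%N.
Proof.
move=> cw; have [jlt wF meet] := covered_first cw.
have [_ sF Ak _] := shell.2 _ jlt.
set Z := block_tails _; set F := nth set0 s (first_facet w).
rewrite -(shell.1 F) ?mem_nth // -(cardsID Z F) leq_add //.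
  by apply: subset_leq_card; apply: subsetIr.
have sub : F :\: Z \subset \bigcup_(A <- As (first_facet w)) (A :\: Z).
  apply/subsetP => b /setDP[bF bZ]; have := bZ; rewrite inE first_facet_mins // bF.
  rewrite -has_predC => /hasP[A AAs] /=; rewrite negb_imply => /andP[bA _].
  by rewrite bigcup_seq; apply/bigcupP; exists A => //; rewrite inE bZ.
apply: leq_trans (subset_leq_card sub) _; apply: card_bigcup_seq_leq => A AAs.
have [a aT /andP[aA _]] := block_mins_meet cw AAs.
have aZ : a \in Z.
  by case/andP: (block_interval_mem cw) => _ /subsetP; apply; apply: (subsetP (block_mins_sub w)).
rewrite -(Ak A AAs) (cardsD1 a A) aA /=; apply: subset_leq_card.
by apply: setDS; rewrite sub1set.
Qed.
End BlockPartition.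

(** For the first facet of w, with core G and t blocks, the surviving class bounds the depth by |G|
    + t. As |G| + t k = d, this equals d - t (k - 1), the lower bound for the top of the interval of
    w. *)
Theorem block_shelling_stanley (K : fieldType) N d k s (As : nat -> seq {set 'I_N})
    (Gm : 'X_{1..N} -> Prop) :
  (0 < k)%N -> block_shelling d k s As ->
  (forall m, Gm m -> ~~ covered s (supp m)) ->
  (forall m, ~~ covered s (supp m) -> exists2 u, Gm u & lem u m) ->
  stanley_conjecture (@mon_gens K N Gm).
Proof.
move=> k0 shell Gm1 Gm2 d0 [[fs [szfs reg]] _].
have sub (A B : {set 'I_N}) : A \subset B -> covered s B -> covered s A.
  move=> AB /hasP[F Fs BF]; apply/hasP; exists F => //; exact: subset_trans BF.
apply: (interval_sdepth K sub Gm1 Gm2 (block_interval_mem shell) (block_interval shell)).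
move=> w cw; have [jlt _ _] := covered_first shell cw.
have := block_tails_card shell cw; have := block_core_card k0 shell jlt.
set j := first_facet s w in jlt *.
have : (d0 <= #|block_core s As j| + size (As j))%N.
  rewrite -szfs leqNgt; apply/negP => elt.
  have [phi [phi0 phic]] := shelling_class k0 shell K jlt.
  have st u : stage s (size s) u = covered s [set x in u].
    rewrite /stage take_size; apply: eq_has => F.
    by apply/esym/eq_subset => x; rewrite inE.
  have [|psi psi0 psiE] := relative_vanishing sub Gm1 Gm2 reg elt phi0.
    by move=> u su cu szu; apply: phic; rewrite ?st.
  by move/(_ psi psi0); apply=> u su; rewrite st => cu szu; apply: psiE.
case: k k0 {shell jlt} => // k _ /=; rewrite mulnS; lia.
Qed.

(** * Shellable complexes and their expansions *)

Section Facets.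
Variable n : nat.
Implicit Types (D : {set {set 'I_n}}) (s : seq {set 'I_n}) (F G w : {set 'I_n}).

Lemma facet_above D w : w \in D -> exists2 F, F \in facets D & w \subset F.
Proof.
move=> wD; have [F /maxsetP[FD Fmax] wF] := @maxset_exists _ (fun B => B \in D) w wD.
exists F => //; rewrite inE FD; apply/forall_inP => G GD; apply/implyP => FG.
by apply/eqP; apply: Fmax.
Qed.

Lemma facet_order_covered D s w : simplicial_complex D -> facet_order D s ->
  covered s w = (w \in D).
Proof.
move=> [_ Dsub] [_ sE]; apply/hasP/idP => [[F Fs wF]|/facet_above[F FD wF]].
  by apply: Dsub wF; move: Fs; rewrite sE inE => /andP[].
by exists F => //; rewrite sE.
Qed.

Definition shell_blocks s j : seq {set 'I_n} :=
  [seq nth set0 s j :\: G | G <- enum (facets (shell_inter s j))].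

(** Complements in F_j turn the facets of the intersection into blocks: a union equal to F_j becomes
    disjointness, and lying in a facet G becomes being disjoint from F_j \ G. *)
Lemma shell_blocks_shelling d k s : (forall F, F \in s -> #|F| = d) ->
  (forall j, (0 < j < size s)%N -> let F := nth set0 s j in
    [/\ (k <= #|F|)%N,
        forall G, G \in facets (shell_inter s j) -> #|G| = (#|F| - k)%N &
        forall G H, G \in facets (shell_inter s j) -> H \in facets (shell_inter s j) ->
          G != H -> F \subset G :|: H]) ->
  block_shelling d k s (shell_blocks s).
Proof.
move=> sd sh; split=> // j jlt; set F := nth set0 s j.
(* The first facet has no predecessors, hence no blocks. *)
have facetF G : G \in facets (shell_inter s j) -> (0 < j)%N /\ G \subset F.
  rewrite inE => /andP[+ _]; rewrite inE => /andP[GF hasG]; split=> //.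
  by case: (posnP j) hasG => // ->; rewrite take0.
split.
- rewrite /disjoint_family pairwise_map.
  have := enum_uniq (facets (shell_inter s j)); rewrite uniq_pairwise.
  apply: (@sub_in_pairwise _ (mem (facets (shell_inter s j)))); last first.
    by apply/allP => G; rewrite mem_enum.
  move=> G H GD HD /= GH; have [j0 _] := facetF G GD.
  have [|_ _ /(_ G H GD HD GH)/subsetP FGH] := sh j; first by rewrite j0.
  rewrite disjoints_subset; apply/subsetP => x; rewrite !inE => /andP[xG xF].
  by have := FGH x xF; rewrite inE (negbTE xG) /= => ->.
- by move=> A /mapP[G _ ->]; apply: subsetDl.
- move=> A /mapP[G]; rewrite mem_enum => GD ->; have [j0 GF] := facetF G GD.
  have [|kF /(_ G GD) Gk _] := sh j; first by rewrite j0.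
  by rewrite cardsD (setIidPr GF) Gk subKn.
- move=> w wF; rewrite -has_predC.
  have -> : has (fun F' => w \subset F') (take j s) = (w \in shell_inter s j).
    by rewrite inE wF.
  apply/idP/hasP => [/facet_above[G GD wG]|[A /mapP[G]]].
    exists (F :\: G); first by apply: map_f; rewrite mem_enum.
    rewrite /= negbK disjoint_sym disjoints_subset setCD.
    by apply: subset_trans wG (subsetUr _ _).
  rewrite mem_enum => GD -> /=; rewrite negbK disjoint_sym disjoints_subset => /subsetP wG.
  have {}wG : w \subset G.
    by apply/subsetP => x xw; have := wG x xw; rewrite !inE (subsetP wF) // andbT negbK.
  move: GD; rewrite !inE => /andP[/andP[_ /hasP[F' F's GF']] _].
  by rewrite wF; apply/hasP; exists F' => //; apply: subset_trans GF'.
Qed.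

Lemma pure_facet_order D s : pure D -> facet_order D s ->
  forall F, F \in s -> #|F| = #|nth set0 s 0|.
Proof.
move=> Dpure [_ sE] F Fs; apply: Dpure; rewrite -sE //.
by apply: mem_nth; case: s Fs {sE}.
Qed.

Lemma SR_mon_nonface D m : SR_mon D m -> supp m \notin D.
Proof. by case. Qed.

Definition indicator F : 'X_{1..n} := [multinom (i \in F : nat) | i < n].

Lemma supp_indicator F : supp (indicator F) = F.
Proof. by apply/setP => i; rewrite inE mnmE; case: (i \in F). Qed.

Lemma SR_mon_indicator D F : F \notin D -> SR_mon D (indicator F).
Proof.
move=> FD; split; first by move=> i; rewrite mnmE; case: (i \in F).
by have := FD; rewrite -{1}[F]supp_indicator.
Qed.

Lemma min_gens_indicator D F : minset (fun B => B \notin D) F ->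
  min_gens (SR_mon D) (indicator F).
Proof.
move=> /minsetP[FD Fmin]; split; first exact: SR_mon_indicator.
move=> v [v1 vD] /supp_sub; rewrite supp_indicator => vF.
have vE : supp v = F by apply: Fmin.
apply/mnmP => i; rewrite mnmE -vE inE.
by case: (v i) (v1 i) => [|[|]].
Qed.

Lemma k_shelling_blocks D k : pure D -> k_shellable D k ->
  exists d s, facet_order D s /\ block_shelling d k s (shell_blocks s).
Proof.
move=> Dpure [/andP[_ kdim] [s [sD sh]]]; exists #|nth set0 s 0|, s; split=> //.
have sd := pure_facet_order Dpure sD.
apply: shell_blocks_shelling => // j /andP[j0 jlt] F.
have [|shk shU] := sh j; first by rewrite j0.
(* By purity no face is larger than F_j, so the bound of k by the dimension gives k <= |F_j|. *)
split=> //; apply: leq_trans kdim _; apply/bigmax_leqP => G /facet_above[H HD GH].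
rewrite (sd F) ?mem_nth // -(sd H) ?sD.2 //; exact: subset_leq_card.
Qed.

(** Shellings have one-element blocks: two distinct subsets of F_j with |F_j| - 1 elements have
    union F_j. *)
Lemma shelling_blocks D : pure D -> shellable D ->
  exists d s, facet_order D s /\ block_shelling d 1 s (shell_blocks s).
Proof.
move=> Dpure [s [sD sh]]; exists #|nth set0 s 0|, s; split=> //.
have sd := pure_facet_order Dpure sD; have [s_uniq sE] := sD.
apply: shell_blocks_shelling => // j jlt F.
have shj := sh j jlt; case/andP: jlt => j0 jlt.
(* An empty F_j would lie in the first facet and not be maximal; hence the truncated [#|F| - 1] is a
   true difference. *)
have F_gt0 : (0 < #|F|)%N.
  rewrite card_gt0; apply/eqP => F0.
  have : F \in facets D by rewrite -sE mem_nth.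
  rewrite inE => /andP[_ /forall_inP/(_ (nth set0 s 0))].
  have s0 : nth set0 s 0 \in s by apply/mem_nth/(leq_trans j0 (ltnW jlt)).
  have /andP[-> _] : (nth set0 s 0 \in D) && true.
    by move: s0; rewrite sE inE => /andP[->].
  move=> /(_ isT); rewrite {1}F0 sub0set /= nth_uniq //; last exact: leq_trans jlt.
  by move/eqP => jE; rewrite -jE in j0.
split=> // G H GD HD GH.
have sub G' : G' \in facets (shell_inter s j) -> G' \subset F.
  by rewrite inE => /andP[+ _]; rewrite inE => /andP[].
have GHF : G :|: H \subset F by rewrite subUset !sub.
suff /eqP-> : G :|: H == F by [].
rewrite eqEcard GHF -(subnK F_gt0) addn1 -(shj G GD); apply: proper_card.
rewrite properE subsetUl; apply: contra GH; rewrite subUset subxx /= => HG.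
by rewrite eq_sym eqEcard HG (shj G GD) (shj H HD) /=.
Qed.
End Facets.

(** * Expansion as the replacement of each vertex by k copies *)

Section Expansion.
Variables n k : nat.
Implicit Types (F A : {set 'I_n}) (w : {set 'I_(nvars n k)}).

Definition xval (x : 'I_(nvars n k)) : 'I_n * 'I_k :=
  enum_val (x : 'I_#|{: 'I_n * 'I_k}|).

Lemma xvalK x : xidx (xval x).1 (xval x).2 = x.
Proof. by rewrite /xidx -surjective_pairing; apply: enum_valK. Qed.

Lemma xidxK i j : xval (xidx i j) = (i, j).
Proof. exact: enum_rankK. Qed.

Definition expand F : {set 'I_(nvars n k)} := [set x | (xval x).1 \in F].
Definition project w : {set 'I_n} := [set (xval x).1 | x in w].

Lemma card_expand F : #|expand F| = (#|F| * k)%N.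
Proof.
have -> : expand F = xval @^-1: setX F setT.
  by apply/setP => x; rewrite !inE andbT.
rewrite on_card_preimset ?cardsX ?cardsT ?card_ord //.
apply: onW_bij; exists (fun p => xidx p.1 p.2) => [x|[i j]].
  exact: xvalK.
exact: xidxK.
Qed.

Lemma sub_expand w F : (w \subset expand F) = (project w \subset F).
Proof.
apply/subsetP/subsetP => [H _ /imsetP[x /H xF ->]|H x xw]; first by rewrite inE in xF.
by rewrite inE; apply/H/imset_f.
Qed.

Lemma disjoint_expand w A : [disjoint expand A & w] = [disjoint A & project w].
Proof.
rewrite disjoint_sym [RHS]disjoint_sym !disjoints_subset.
have -> : ~: expand A = expand (~: A) by apply/setP => x; rewrite !inE.
exact: sub_expand.
Qed.

Lemma covered_expand s w : covered (map expand s) w = covered s (project w).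
Proof. by rewrite /covered has_map; apply: eq_has => F /=; rewrite sub_expand. Qed.

(** Inclusion in an expanded set and disjointness from it depend on the projection only, so the
    shelling condition carries over while cardinalities are multiplied by k. *)
Lemma block_shelling_expand d c s As : block_shelling d c s As ->
  block_shelling (d * k) (c * k) (map expand s) (fun j => map expand (As j)).
Proof.
move=> [sd sh]; split=> [_ /mapP[F Fs ->]|j]; first by rewrite card_expand sd.
rewrite size_map => jlt; have [dj sF Ac cov] := sh j jlt.
rewrite (nth_map set0) //; split.
- rewrite /disjoint_family pairwise_map; apply: sub_pairwise dj => A B.
  rewrite /= !disjoints_subset => /subsetP AB.
  by apply/subsetP => x; rewrite !inE => /AB; rewrite inE.
- move=> _ /mapP[A AAs ->]; apply/subsetP => x; rewrite !inE.
  exact: (subsetP (sF A AAs)).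
- by move=> _ /mapP[A AAs ->]; rewrite card_expand Ac.
- move=> w; rewrite sub_expand => /cov covw; rewrite -map_take has_map all_map.
  rewrite (eq_has (a2 := fun F => project w \subset F)) => [|F]; last first.
    by rewrite /= sub_expand.
  by rewrite covw; congr (~~ _); apply: eq_all => A; rewrite /= disjoint_expand.
Qed.

Lemma expansion_nonface (D : {set {set 'I_n}}) m :
  expansion_mon k (SR_mon D) m -> project (supp m) \notin D.
Proof.
move=> [u [[/SR_mon_nonface + _] uE]]; rewrite (_ : project _ = supp u) //.
apply/setP => i; rewrite inE -uE sum_nat_eq0 negb_forall; apply/imsetP/existsP.
  by case=> x; rewrite inE => mx ->; exists (xval x).2; rewrite xvalK.
by case=> j /= mj; exists (xidx i j); rewrite ?inE // xidxK.
Qed.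

Lemma nonface_expansion (D : {set {set 'I_n}}) m : project (supp m) \notin D ->
  exists2 u, expansion_mon k (SR_mon D) u & lem u m.
Proof.
move=> mD; have [F Fmin /subsetP Fm] := minset_exists (P := fun B => B \notin D) mD.
(* For each vertex of a minimal nonface F below m, one of its copies dividing m is chosen; the
   product of these copies is a generator dividing m. *)
pose f i := [pick j : 'I_k | m (xidx i j) != 0%N].
exists [multinom (((xval x).1 \in F) && (f (xval x).1 == Some (xval x).2) : nat)
  | x < nvars n k].
  exists (indicator F); split=> [|i]; first exact: min_gens_indicator.
  under eq_bigr => j _ do rewrite mnmE xidxK /=.
  rewrite mnmE; case: (boolP (i \in F)) => [/Fm/imsetP[x]|_]; last by rewrite big1.
  rewrite inE => mx iE; rewrite /f; case: pickP => [j mj|/(_ (xval x).2)].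
    by rewrite (bigD1 j) //= eqxx big1 // => j' /negbTE; rewrite eq_sym => jj';
      rewrite (inj_eq Some_inj) jj'.
  by rewrite iE xvalK mx.
apply/mnm_lepP => x; rewrite mnmE; case: andP => // -[_].
by rewrite /f; case: pickP => // j mj /eqP[jE]; rewrite lt0n -(xvalK x) -jE.
Qed.
End Expansion.

Theorem theorem3p2 :
  (forall (K : fieldType) (n : nat) (D : {set {set 'I_n}}) (k : nat),
      simplicial_complex D -> pure D -> shellable D -> (0 < k)%N ->
      stanley_conjecture (SR_expansion K k D)) /\
  (forall (K : fieldType) (n : nat) (D : {set {set 'I_n}}) (k : nat),
      simplicial_complex D -> pure D -> k_shellable D k ->
      stanley_conjecture (SR_ideal K D)).
Proof.
split=> K n D k Dcx Dpure.
  move=> /(shelling_blocks Dpure)[d [s [sD shell]]] k_gt0.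
  have := block_shelling_expand k shell; rewrite mul1n => shell'.
  apply: (block_shelling_stanley k_gt0 shell') => m;
    rewrite covered_expand (facet_order_covered _ Dcx sD).
  - exact: expansion_nonface.
  - exact: nonface_expansion.
move=> Dk; have [/andP[k_gt0 _] _] := Dk.
have [d [s [sD shell]]] := k_shelling_blocks Dpure Dk.
apply: (block_shelling_stanley k_gt0 shell) => m;
  rewrite (facet_order_covered _ Dcx sD); first exact: SR_mon_nonface.
move=> mD; exists (indicator (supp m)); first exact: SR_mon_indicator.
by apply/mnm_lepP => i; rewrite mnmE inE; case: (m i).
Qed.
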